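(* Let $\mathbb{G}$ be a Carnot group with horizontal layer $\mathfrak{g}_1$, and let $\mathfrak{O} \subset \mathfrak{g}_1$ be a subset. If every vector in $\mathfrak{O}$ is pliable, then $\mathbb{G}$ has the $C^1_H$ Whitney extension property on $\mathfrak{O}$.
   Context: A Carnot group $\mathbb{G}$ is a connected, simply connected Lie group whose Lie algebra (of left invariant vector fields) has a decomposition $\mathfrak{g}=\mathfrak{g}_1\oplus\cdots\oplus\mathfrak{g}_s$ with $\mathfrak{g}_i=[\mathfrak{g}_1,\mathfrak{g}_{i-1}]$ for $2\le i\le s$ and $[\mathfrak{g}_1,\mathfrak{g}_s]=0$; $\mathfrak{g}_1$ is the horizontal layer. Let $0$ denote the identity of $\mathbb{G}$ and $\exp:\mathfrak{g}\to\mathbb{G}$ the exponential map (a diffeomorphism). Identify $\mathbb{G}$ with $\mathbb{R}^n$ by exponential coordinates. Fix a basis $X_1,\dots,X_n$ of $\mathfrak{g}$ adapted to the stratification, so that $X_1,\dots,X_r$ is a basis of $\mathfrak{g}_1$, and let $\|\cdot\|$ be the inner product norm on $\mathfrak{g}_1$ making $X_1,\dots,X_r$ orthonormal. An absolutely continuous curve $\gamma:[a,b]\to\mathbb{G}$ is horizontal if for almost every $t$ its velocity is $\sum_{j=1}^r u_j(t)X_j(\gamma(t))$ for some $u=(u_1,\dots,u_r)\in L^1$; its length is $\int_a^b|u|$. At such $t$ write $\gamma'(t):=\sum_{j=1}^r u_j(t)X_j\in\mathfrak{g}_1$. The Carnot-Carathéodory distance $d(x,y)$ is the infimum of the lengths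 of horizontal curves joining $x$ to $y$. For an interval $I\subset\mathbb{R}$, $C^1_H(I,\mathbb{G})$ is the set of curves $\gamma:I\to\mathbb{G}$ that are continuously differentiable and horizontal (equivalently, $\gamma':I\to\mathfrak{g}_1$ exists everywhere and is continuous). The space $C^1_H([a,b],\mathbb{G})$ carries the metric $\max\left(\sup_{t\in[a,b]} d(\gamma_1(t),\gamma_2(t)),\ \sup_{t\in[a,b]}\|\gamma_2'(t)-\gamma_1'(t)\|\right)$. A curve $\gamma\in C^1_H([a,b],\mathbb{G})$ is pliable if for every neighborhood $\mathcal{V}$ of $\gamma$ in $C^1_H([a,b],\mathbb{G})$ the set $\{(\beta(b),\beta'(b)):\beta\in\mathcal{V},\ (\beta(a),\beta'(a))=(\gamma(a),\gamma'(a))\}$ is a neighborhood of $(\gamma(b),\gamma'(b))$ in $\mathbb{G}\times\mathfrak{g}_1$. A vector $V\in\mathfrak{g}_1$ is pliable if the curve $t\mapsto\exp(tV)$, $t\in[0,1]$, is pliable. $\mathbb{G}$ has the $C^1_H$ Whitney extension property on $\mathfrak{O}\subset\mathfrak{g}_1$ if the following holds: for every compact $K\subset\mathbb{R}$, every continuous $\gamma:K\to\mathbb{G}$ and every continuous $X:K\to\mathfrak{O}$, if $$r_{K,\eta}:=\sup_{\tau,t\in K,\ 0<|\tau-t|<\eta}\frac{d(\gamma(t),\gamma(\tau)\exp((t-\tau)X(\tau)))}{|\tau-t|}$$ satisfies $r_{K,\eta}\to0$ as $\eta\downarrow0$, then there is a curve $\Gamma\in C^1_H(\mathbb{R},\mathbb{G})$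 with $\Gamma|_K=\gamma$ and $\Gamma'|_K=X$. *)

(* Defs.v *)
From HB Require Import structures.
From mathcomp Require Import all_boot all_order all_algebra.
From mathcomp Require Import all_classical all_reals all_analysis.

Set Implicit Arguments.
Unset Strict Implicit.
Unset Printing Implicit Defensive.

Import Order.TTheory GRing.Theory Num.Theory.
Import numFieldNormedType.Exports.

Local Open Scope classical_set_scope.
Local Open Scope ring_scope.

Section Calculus.
Context {R : realType}.

Fixpoint Ck {V W : normedModType R} (k : nat) (f : V -> W) : Prop :=
  if k is k'.+1 then
    (forall x, differentiable f x) /\ (forall v, Ck k' (fun x => 'd f x v))
  else continuous f.

Definition smooth {V W : normedModType R} (f : V -> W) : Prop :=
  forall k, Ck k f.

(* One-sided at an endpoint of an interval [A], ordinary when [A] is a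
   neighborhood of [t]. *)
Definition is_derive_within {W : normedModType R} (A : set R) (f : R -> W)
    (t : R) (v : W) : Prop :=
  (fun s => (s - t)^-1 *: (f s - f t)) @ within A t^' --> v.

Definition abs_continuous {W : normedModType R} (a b : R) (f : R -> W) : Prop :=
  forall e : R, 0 < e -> exists2 delta : R, 0 < delta &
    forall (k : nat) (c d : 'I_k -> R),
      (forall i, a <= c i /\ c i < d i /\ d i <= b) ->
      (forall i j, i != j -> d i <= c j \/ d j <= c i) ->
      \sum_(i < k) (d i - c i) < delta ->
      \sum_(i < k) `|f (d i) - f (c i)| < e.

(* The norm of the library on ['rV_r] is the sup norm. *)
Definition enorm {r : nat} (u : 'rV[R]_r) : R :=
  Num.sqrt (\sum_(j < r) u 0 j ^+ 2).

Definition lie_bracket {n : nat} (X Y : 'rV[R]_n -> 'rV[R]_n) (p : 'rV[R]_n) :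
    'rV[R]_n :=
  'D_(X p) Y p - 'D_(Y p) X p.

Definition basis_vec {n : nat} (j : 'I_n) : 'rV[R]_n := delta_mx 0 j.

End Calculus.

(* A Lie group with underlying manifold R^n, in exponential coordinates: the
   last field says that [t |-> t *: v] is the one-parameter subgroup with
   velocity [v] at the identity 0, i.e. that exp sends the tangent vector [v]
   at 0 to the point [v]. In particular the inverse of [x] is [- x]. *)
Record lie_group (R : realType) (n : nat) := LieGroup {
  gmul : 'rV[R]_n -> 'rV[R]_n -> 'rV[R]_n ;
  gmul_smooth : smooth (fun p : 'rV[R]_n * 'rV[R]_n => gmul p.1 p.2) ;
  gmulA : associative gmul ;
  gmul0l : left_id 0 gmul ;
  gmul0r : right_id 0 gmul ;
  gmul_exp : forall (v : 'rV[R]_n) (s t : R),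
    gmul (s *: v) (t *: v) = (s + t) *: v }.

Section LieGroup.
Context {R : realType} {n : nat} (G : lie_group R n).

(* The left invariant vector field with value [v] at 0; the Lie algebra is
   identified with R^n through [v |-> linv v], the basis X_1, ..., X_n
   being the image of the canonical basis. *)
Definition linv (v p : 'rV[R]_n) : 'rV[R]_n := 'D_v (gmul G p) 0.

Definition bracket (v w : 'rV[R]_n) : 'rV[R]_n :=
  lie_bracket (linv v) (linv w) 0.

(* [C] is [[A, B]], the linear span of the brackets. *)
Definition is_bracket_space (A B C : {vspace 'rV[R]_n}) : Prop :=
  (forall x y, x \in A -> y \in B -> bracket x y \in C) /\
  (forall D : {vspace 'rV[R]_n},
    (forall x y, x \in A -> y \in B -> bracket x y \in D) -> (C <= D)%VS).

(* The identity, because of the choice of coordinates. *)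
Definition expg (v : 'rV[R]_n) : 'rV[R]_n := v.

End LieGroup.

(* [r] is the dimension of the horizontal layer, [r + m] that of the group. *)
Record carnot_group (R : realType) (r m : nat) := CarnotGroup {
  carnot_lie :> lie_group R (r + m) ;
  step : nat ;
  layer : nat -> {vspace 'rV[R]_(r + m)} ;
  step_gt0 : (0 < step)%N ;
  layer_sum : (\sum_(i < step) layer i.+1)%VS = fullv ;
  layer_direct : directv (\sum_(i < step) layer i.+1)%VS ;
  layer_bracket : forall i, (2 <= i <= step)%N ->
    is_bracket_space carnot_lie (layer 1) (layer i.-1) (layer i) ;
  layer_bracket_last : forall x y, x \in layer 1 -> y \in layer step ->
    bracket carnot_lie x y = 0 ;
  (* the canonical basis is adapted to the stratification *)
  layer_adapted : forall i, (1 <= i <= step)%N ->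
    layer i = <<[seq basis_vec j | j <- enum 'I_(r + m)
                                  & basis_vec j \in layer i]>>%VS ;
  layer1P : forall j : 'I_(r + m), (basis_vec j \in layer 1) = (j < r)%N }.

Section Carnot.
Context {R : realType} {r m : nat} (G : carnot_group R r m).
Local Notation mu := (@lebesgue_measure R).

(* g_1 is represented by ['rV_r], the coordinates in the basis X_1, ..., X_r. *)
Definition hor (u : 'rV[R]_r) : 'rV[R]_(r + m) := row_mx u 0.

Definition horizontal (a b : R) (gamma : R -> 'rV[R]_(r + m))
    (u : R -> 'rV[R]_r) : Prop :=
  [/\ abs_continuous a b gamma,
      forall j : 'I_r, mu.-integrable `[a, b] (fun t => (u t 0 j)%:E) &
      {ae mu, forall t, t \in `]a, b[ ->
        is_derive t 1 gamma (linv G (hor (u t)) (gamma t))}].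

Definition curve_length (a b : R) (u : R -> 'rV[R]_r) : \bar R :=
  (\int[mu]_(t in `[a, b]) (enorm (u t))%:E)%E.

Definition cc_dist (x y : 'rV[R]_(r + m)) : \bar R :=
  ereal_inf [set L | exists (a b : R) gamma u,
    [/\ a < b, horizontal a b gamma u, gamma a = x, gamma b = y &
        L = curve_length a b u]].

(* Only the values on the interval [I] are relevant. *)
Record C1H (I : set R) := MkC1H {
  curve :> R -> 'rV[R]_(r + m) ;
  velocity : R -> 'rV[R]_r ;
  curve_derive : forall t, I t ->
    is_derive_within I curve t (linv G (hor (velocity t)) (curve t)) ;
  velocity_continuous : {within I, continuous velocity} }.

Definition C1H_dist (I : set R) (g1 g2 : C1H I) : \bar R :=
  Order.max (ereal_sup [set cc_dist (g1 t) (g2 t) | t in I])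
    (ereal_sup [set (enorm (velocity g2 t - velocity g1 t))%:E | t in I]).

Definition C1H_nbhs (I : set R) (g : C1H I) (V : set (C1H I)) : Prop :=
  exists2 e : R, 0 < e & [set h | (C1H_dist g h < e%:E)%E] `<=` V.

Definition pliable (a b : R) (g : C1H `[a, b]) : Prop :=
  forall V : set (C1H `[a, b]), C1H_nbhs g V ->
    nbhs (g b, velocity g b)
      [set (h b, velocity h b) | h in
        [set h | V h /\ (h a, velocity h a) = (g a, velocity g a)]].

Lemma linv_exp (v : 'rV[R]_(r + m)) (t : R) : linv G v (t *: v) = v.
Proof.
rewrite /linv /derive.
have E : \forall h \near 0^',
    h^-1 *: (gmul G (t *: v) (h *: v + 0) - gmul G (t *: v) 0) = v.
  near=> h; rewrite addr0 gmul0r gmul_exp scalerDl addrAC subrr add0r scalerA.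
  rewrite mulVf ?scale1r//; near: h; exact: nbhs_dnbhs_neq.
apply: cvg_lim; first exact: norm_hausdorff.
exact: cvg_near_cst.
Unshelve. all: by end_near. Qed.

Lemma exp_curve_derive (I : set R) (V : 'rV[R]_r) (t : R) : I t ->
  is_derive_within I (fun t => expg (t *: hor V)) t
    (linv G (hor V) (expg (t *: hor V))).
Proof.
move=> _; rewrite linv_exp /is_derive_within /expg.
apply: cvg_near_cst; apply: cvg_within; near=> s.
rewrite -scalerBl scalerA mulVf ?scale1r// subr_eq0.
by near: s; exact: nbhs_dnbhs_neq.
Unshelve. all: by end_near. Qed.

Lemma exp_velocity_continuous (I : set R) (V : 'rV[R]_r) :
  {within I, continuous (fun _ : R => V)}.
Proof. by apply: continuous_subspaceT => x; exact: cst_continuous. Qed.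

Definition exp_curve (I : set R) (V : 'rV[R]_r) : C1H I :=
  MkC1H (fun t => @exp_curve_derive I V t) (@exp_velocity_continuous I V).

Definition pliable_vector (V : 'rV[R]_r) : Prop :=
  pliable (exp_curve `[0, 1] V).

(* The maximum with 0 makes the supremum over the empty set equal to 0 (and
   not to -oo), as is needed for instance when [K] is finite. *)
Definition whitney_rate (K : set R) (gamma : R -> 'rV[R]_(r + m))
    (X : R -> 'rV[R]_r) (eta : R) : \bar R :=
  Order.max 0%E (ereal_sup [set e | exists tau t,
    [/\ K tau, K t, 0 < `|tau - t| < eta &
        e = (cc_dist (gamma t)
               (gmul G (gamma tau) (expg ((t - tau) *: hor (X tau))))
             * (`|tau - t|^-1)%:E)%E]]).

Definition whitney_extension (O : set 'rV[R]_r) : Prop :=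
  forall (K : set R) (gamma : R -> 'rV[R]_(r + m)) (X : R -> 'rV[R]_r),
    compact K ->
    {within K, continuous gamma} ->
    {within K, continuous X} ->
    (forall t, K t -> O (X t)) ->
    whitney_rate K gamma X eta @[eta --> 0^'+] --> 0%E ->
    exists Gamma : C1H setT,
      forall t, K t -> Gamma t = gamma t /\ velocity Gamma t = X t.

End Carnot.

(* Main.v *)
Require Import Defs.
From HB Require Import structures.
From mathcomp Require Import all_boot all_order all_algebra.
From mathcomp Require Import all_classical all_reals all_analysis.
From mathcomp Require Import measurable_realfun.
From mathcomp Require Import ring lra.

Set Implicit Arguments.
Unset Strict Implicit.
Unset Printing Implicit Defensive.
Import Order.TTheory GRing.Theory Num.Theory.
Import numFieldNormedType.Exports.
Local Open Scope classical_set_scope.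
Local Open Scope ring_scope.

(** To extend the curve one has to insert, in each gap [c1 < c2] of [K], a
    horizontal curve of class C^1 with prescribed ends and end velocities, in
    such a way that near any point [t] of [K] all inserted velocities are close
    to [X t]; the extension is then differentiable at [t] by the Whitney
    condition on [K] and the mean value inequality in the gaps
    ([filled_cont], [filled_deriv]).

    Short gaps. After a left translation and a dilation of ratio
    [(c2 - c1)^-1], the Whitney condition says that the point to reach is close
    to [hor (X t)] ([cc_dist_bound], [gamma_expansion]), and pliability of
    [X t] provides a curve with velocity close to [X t]. Pliability fixes the
    initial velocity, whereas here it is [X c1], only close to [X t]. But time
    reversal composed with the dilation of ratio -1 exchanges the initial and
    final velocities, so that a curve given by pliability also leads from the
    velocity [X c1] back to [X t]; a concatenation then gives the required
    uniformity ([pliable_connects_near_open]) without solving any differential equation.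

    Long gaps. There closeness is not required, but some curve must exist. The
    points reachable from the identity with zero velocity at both ends form a
    subgroup, which has an interior point as soon as one horizontal vector is
    pliable, and therefore is the whole group ([pliable_connects]).

    Dilations. The linear map [dil] multiplying each layer by a power of the
    ratio preserves brackets, by the Jacobi identity and because the first
    layer generates. It then preserves the product as well: in exponential
    coordinates the product is determined by the bracket ([bracket_auto]),
    through the adjoint action and the Maurer-Cartan form along rays.

    Distances. Only a lower bound on the Carnot-Caratheodory distance is
    needed: length controls displacement ([horizontal_bound]). The curves
    defining the distance are only absolutely continuous, so that it rests on
    [ac_increment]: an absolutely continuous function whose increments are
    dominated, near almost every point, by those of a nondecreasing function is
    dominated by it globally. *)

(** * Derivatives and estimates within a subset of the line *)

Section Calc.
Context {R : realType}.

(** The supremum of the points satisfying [P] satisfies [P] by the last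
    hypothesis, and is not smaller than [b] by the previous one. Local
    estimates become global ones in this way. *)
Lemma real_induction (a b : R) (P : R -> Prop) : a <= b -> P a ->
  (forall t, a <= t -> t < b -> P t -> exists2 d, 0 < d &
     forall s, t < s -> s < t + d -> s <= b -> P s) ->
  (forall t, a < t -> t <= b -> exists2 d, 0 < d &
     forall s, t - d < s -> s < t -> a <= s -> P s -> P t) ->
  P b.
Proof.
move=> ab Pa Pr Pl; set S := [set t | [/\ a <= t, t <= b & P t]].
have S0 : S a by split.
have ubS : ubound S b by move=> t [].
have hS : has_sup S by split; [exists a | exists b].
have as_ : a <= sup S by apply: ub_le_sup => //; exists b.
have sb : sup S <= b by apply: ge_sup => //; exists a.
have Ps : P (sup S).
  move: as_; rewrite le_eqVlt => /predU1P[<-//|as_].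
  have [d d0 Pd] := Pl _ as_ sb.
  have [t [at_ tb Pt] st] := sup_adherent d0 hS.
  have : t <= sup S by apply: ub_le_sup => //; exists b.
  rewrite le_eqVlt => /predU1P[<-//|ts]; exact: Pd Pt.
move: sb; rewrite le_eqVlt => /predU1P[<-//|sb].
have [d d0 Pd] := Pr _ as_ sb Ps.
have [x0 x1] : sup S < Num.min b (sup S + d / 2) /\ 0 < d/2.
  by rewrite lt_min sb ltrDl /=; split; lra.
have : S (Num.min b (sup S + d / 2)).
  split; first by rewrite (le_trans as_)// ltW.
    by rewrite ge_min lexx.
  apply: Pd => //; last by rewrite ge_min lexx.
  rewrite gt_min; apply/orP; right; lra.
by move/(ub_le_sup (ex_intro _ b ubS)); rewrite leNgt x0.
Qed.

(** The common shape of differentiability and continuity within a set, so that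
    localizing and gluing are proved once. *)
Definition near_in (A : set R) (t : R) (Q : R -> R -> Prop) :=
  forall e : R, 0 < e -> exists2 d : R, 0 < d &
    forall s, A s -> `|s - t| < d -> Q e s.

Lemma near_in_local A B t Q d0 : 0 < d0 ->
  (forall s, A s -> `|s - t| < d0 -> B s) -> near_in B t Q -> near_in A t Q.
Proof.
move=> d00 AB h e e0; have [d dp hd] := h e e0.
exists (Num.min d d0); first by rewrite lt_min dp.
by move=> s As; rewrite lt_min => /andP[sd s0]; apply: hd => //; exact: AB.
Qed.

Lemma near_in_glue A (b : R) t Q :
  (t <= b -> near_in (A `&` [set s | s <= b]) t Q) ->
  (b <= t -> near_in (A `&` [set s | b <= s]) t Q) -> near_in A t Q.
Proof.
move=> h1 h2; case: (ltgtP t b) => [tb|bt|tb].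
- have d0 : 0 < b - t by rewrite subr_gt0.
  apply: (near_in_local d0 _ (h1 (ltW tb))) => s As sb; split => //=.
  by have := le_lt_trans (ler_norm _) sb; rewrite ltrD2r => /ltW.
- have d0 : 0 < t - b by rewrite subr_gt0.
  apply: (near_in_local d0 _ (h2 (ltW bt))) => s As; rewrite distrC => sb; split => //=.
  by have := le_lt_trans (ler_norm _) sb; rewrite ltrD2l ltrN2 => /ltW.
- move=> e e0; have [|d d0 hd] := h1 _ e e0; first by rewrite tb.
  have [|d' d'0 hd'] := h2 _ e e0; first by rewrite tb.
  exists (Num.min d d'); first by rewrite lt_min d0.
  move=> s As; rewrite lt_min => /andP[sd sd'].
  by case: (leP s b) => sb; [apply: hd|apply: hd' => //; split => //; exact: ltW].
Qed.

(** [is_derive_within] as an explicit estimate, see [deriv_in_within]. It is a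
    [Variant] so that unification never unfolds it. *)
Variant deriv_in {V : normedModType R} (A : set R) (f : R -> V) (t : R) (v : V) : Prop :=
  DerivIn of (forall e : R, 0 < e -> exists2 d : R, 0 < d &
    forall s, A s -> `|s - t| < d -> `|f s - f t - (s - t) *: v| <= e * `|s - t|).

Lemma deriv_inP {V : normedModType R} A (f : R -> V) t (v : V) : deriv_in A f t v <->
  forall e : R, 0 < e -> exists2 d : R, 0 < d & forall s, A s -> `|s - t| < d ->
    `|f s - f t - (s - t) *: v| <= e * `|s - t|.
Proof. by split=> [[]|]. Qed.

Lemma quotient_norm (V : normedModType R) (x v : V) (k : R) : k != 0 ->
  `|k^-1 *: x - v| = `|k|^-1 * `|x - k *: v|.
Proof.
by move=> k0; rewrite -normfV -normrZ scalerBr scalerA mulVf// scale1r.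
Qed.

Lemma deriv_in_within (V : normedModType R) A (f : R -> V) t v :
  is_derive_within A f t v <-> deriv_in A f t v.
Proof.
split=> [/cvgrPdistC_le h|[h]].
  split=> e e0.
  have := h e e0; rewrite near_withinE /= => /nbhs_ballP[d /= d0 hd].
  exists d => // s As sd.
  have [->|st] := eqVneq s t; first by rewrite !subrr scale0r subrr !normr0 mulr0.
  have := hd s; rewrite /ball /= distrC => /(_ sd st As).
  have st0 : s - t != 0 by rewrite subr_eq0.
  by rewrite quotient_norm// ler_pdivrMl ?normr_gt0// mulrC.
apply/cvgrPdistC_le => e e0; rewrite near_withinE /=.
have [d d0 hd] := h e e0; apply/nbhs_ballP; exists d => //= s.
rewrite /ball /= distrC => sd st As; have {hd} := hd s As sd.
have st0 : s - t != 0 by rewrite subr_eq0.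
by rewrite quotient_norm// ler_pdivrMl ?normr_gt0// mulrC.
Qed.

Lemma is_derive_deriv_in (V : normedModType R) (f : R -> V) (t : R) (v : V) :
  is_derive t (1 : R) f v -> deriv_in setT f t v.
Proof.
move=> -[df <-]; apply/deriv_in_within; rewrite /is_derive_within.
have : (fun h => h^-1 *: (f (h *: 1 + t) - f t)) @ 0^' --> 'D_1 f t by exact: df.
move=> /cvgrPdistC_le h; apply/cvgrPdistC_le => e e0; have := h e e0.
rewrite !near_withinE => /nbhs_ballP[d /= d0 hd]; apply/nbhs_ballP; exists d => //= s.
rewrite /ball /= => sd st _; have := hd (s - t).
by rewrite /ball /= sub0r normrN distrC subr_eq0 [(s - t) *: 1]mulr1 subrK; apply.
Qed.

Lemma deriv_inS (V : normedModType R) A B (f : R -> V) t v :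
  A `<=` B -> deriv_in B f t v -> deriv_in A f t v.
Proof. by move=> AB [h]; split=> e /h[d d0 hd]; exists d => // s As; apply: hd; exact: AB. Qed.

Lemma deriv_in_ext (V : normedModType R) A (f g : R -> V) t v d0 :
  0 < d0 -> (forall s, A s -> `|s - t| < d0 -> f s = g s) -> f t = g t ->
  deriv_in A f t v -> deriv_in A g t v.
Proof.
move=> d00 fg fgt [h]; split=> e /h[d dp hd]; exists (Num.min d d0); first by rewrite lt_min dp.
by move=> s As; rewrite lt_min => /andP[? ?]; rewrite -fg// -fgt; apply: hd.
Qed.

Lemma deriv_in_near (V : normedModType R) A (f : R -> V) t v : deriv_in A f t v ->
  forall e, 0 < e -> exists2 d, 0 < d & forall s, A s -> `|s - t| < d ->
    `|f s - f t| < e.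
Proof.
move=> [h] e e0; have [d d0 hd] := h 1 ltr01.
have k0 : 0 < 1 + `|v| by rewrite ltr_wpDr.
exists (Num.min d (e / (1 + `|v|))); first by rewrite lt_min d0 divr_gt0.
move=> s As; rewrite lt_min => /andP[/(hd _ As) h1]; rewrite ltr_pdivlMr// => h2.
rewrite -[f s - f t](subrK ((s - t) *: v)); apply: le_lt_trans (ler_normD _ _) _.
rewrite normrZ; apply: le_lt_trans h2; rewrite mulrDr mulr1.
by apply: lerD => //; rewrite mul1r in h1.
Qed.

Lemma deriv_in_unique (V : normedModType R) (f : R -> V) t v w :
  deriv_in setT f t v -> deriv_in setT f t w -> v = w.
Proof.
move=> [hv] [hw]; apply/eqP; rewrite -subr_eq0 -normr_eq0; apply/eqP.
apply/eqP; rewrite eq_le normr_ge0 andbT; apply/ler_addgt0Pl => e e0.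
have e20 : 0 < e / 2 by lra.
have [d d0 hd] := hv _ e20; have [d' d'0 hd'] := hw _ e20.
pose k := Num.min d d' / 2.
have m0 : 0 < Num.min d d' by rewrite lt_min d0.
have k0 : 0 < k by rewrite /k; lra.
have kk : k < Num.min d d' by rewrite /k; lra.
move: kk; rewrite lt_min => /andP[kd kd'].
have E : `|t + k - t| = k by rewrite addrC addKr gtr0_norm.
have := hd (t + k) I; rewrite E => /(_ kd) h1.
have := hd' (t + k) I; rewrite E => /(_ kd') h2.
have : `|k *: (v - w)| <= e * k.
  have -> : k *: (v - w) = (f (t + k) - f t - (t + k - t) *: w) -
      (f (t + k) - f t - (t + k - t) *: v).
    by rewrite opprB [RHS]addrC addrA subrK (addrC t) addrK scalerBr.
  apply: le_trans (ler_normB _ _) _; apply: le_trans (lerD h2 h1) _.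
  by rewrite -mulrDl -splitr.
by rewrite normrZ gtr0_norm// mulrC ler_pM2r// addr0.
Qed.

Lemma deriv_in_cst (V : normedModType R) A (c : V) t : deriv_in A (fun=> c) t 0.
Proof.
split=> e e0; exists 1 => // s _ _.
by rewrite subrr scaler0 subrr normr0 mulr_ge0// ltW.
Qed.

Lemma deriv_in_scale (V : normedModType R) A (v : V) t : deriv_in A (fun s => s *: v) t v.
Proof.
split=> e e0; exists 1 => // s _ _.
by rewrite scalerBl subrr normr0 mulr_ge0// ltW.
Qed.

Lemma deriv_inD (V : normedModType R) A (f g : R -> V) t v w :
  deriv_in A f t v -> deriv_in A g t w -> deriv_in A (fun s => f s + g s) t (v + w).
Proof.
move=> [hv] [hw]; split=> e e0; have e20 : 0 < e / 2 by lra.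
have [d d0 hd] := hv _ e20; have [d' d'0 hd'] := hw _ e20.
exists (Num.min d d'); first by rewrite lt_min d0.
move=> s As; rewrite lt_min => /andP[/(hd _ As) h1 /(hd' _ As) h2].
rewrite (_ : _ - _ = (f s - f t - (s - t) *: v) + (g s - g t - (s - t) *: w)).
  by apply: le_trans (ler_normD _ _) _; rewrite (splitr e) mulrDl lerD.
by rewrite scalerDr !opprD [f s + g s + _]addrACA [RHS]addrACA.
Qed.

Lemma deriv_in_pair (V W : normedModType R) A (f : R -> V) (g : R -> W) t v w :
  deriv_in A f t v -> deriv_in A g t w -> deriv_in A (fun s => (f s, g s)) t (v, w).
Proof.
move=> [hv] [hw]; split=> e e0.
have [d d0 hd] := hv _ e0; have [d' d'0 hd'] := hw _ e0.
exists (Num.min d d'); first by rewrite lt_min d0.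
move=> s As; rewrite lt_min => /andP[/(hd _ As) h1 /(hd' _ As) h2].
by rewrite [leLHS]prod_normE /= ge_max h1.
Qed.

Lemma deriv_in_affine (V : normedModType R) A B (f : R -> V) t v (al be : R) :
  (forall s, A s -> B (al + be * s)) ->
  deriv_in B f (al + be * t) v -> deriv_in A (fun s => f (al + be * s)) t (be *: v).
Proof.
move=> AB [h]; split=> e e0.
have k0 : 0 < 1 + `|be| by rewrite ltr_wpDr.
have [d d0 hd] := h (e / (1 + `|be|)) (divr_gt0 e0 k0).
exists (d / (1 + `|be|)); first exact: divr_gt0.
move=> s As; rewrite ltr_pdivlMr// => st.
have E : al + be * s - (al + be * t) = be * (s - t) by ring.
have bs : `|be * (s - t)| <= `|s - t| * (1 + `|be|).
  by rewrite normrM mulrC ler_wpM2l// lerDr.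
have := hd _ (AB _ As); rewrite E => /(_ (le_lt_trans bs st)).
rewrite scalerA (mulrC (s - t) be) => /le_trans; apply; apply: le_trans (ler_wpM2l _ bs) _.
  by rewrite ltW// divr_gt0.
by rewrite mulrCA mulfVK ?gt_eqF// mulrC.
Qed.

Lemma diff_eps (V W : normedModType R) (F : V -> W) p : differentiable F p ->
  forall e, 0 < e -> exists2 d, 0 < d & forall q, `|q - p| < d ->
    `|F q - F p - 'd F p (q - p)| <= e * `|q - p|.
Proof.
move=> /diff_locallyP[_ /eqaddoP h] e e0.
have /nbhs_ballP[d /= d0 hd] := h e e0; exists d => // q qp.
have := hd (q - p); rewrite -ball_normE /= sub0r normrN => /(_ qp).
by rewrite !fctE /= /shift /= subrK opprD addrA.
Qed.

Lemma deriv_in_chain (V W : normedModType R) A (F : V -> W) (f : R -> V) t v :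
  deriv_in A f t v -> differentiable F (f t) ->
  deriv_in A (fun s => F (f s)) t ('d F (f t) v).
Proof.
move=> hf dF; split=> e e0.
have [k k0 hk] : exists2 k, 0 < k & forall x, `|'d F (f t) x| <= k * `|x|.
  by apply: linear_lipschitz; exact: diff_continuous.
have v0 : 0 < 1 + `|v| by rewrite ltr_wpDr.
have e10 : 0 < e / 2 / (1 + `|v|) by rewrite !divr_gt0.
have e20 : 0 < Num.min 1 (e / 2 / k) by rewrite lt_min ltr01 !divr_gt0.
have [d1 d10 hd1] := diff_eps dF e10.
have [d2 d20 hd2] := (deriv_inP _ _ _ _).1 hf _ e20.
have [d3 d30 hd3] := deriv_in_near hf d10.
exists (Num.min d2 d3); first by rewrite lt_min d20.
move=> s As; rewrite lt_min => /andP[/(hd2 _ As) h2 /(hd3 _ As) h3].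
have {}h1 := hd1 _ h3.
have -> : F (f s) - F (f t) - (s - t) *: 'd F (f t) v =
   (F (f s) - F (f t) - 'd F (f t) (f s - f t)) +
   'd F (f t) (f s - f t - (s - t) *: v).
  have -> : 'd F (f t) (f s - f t - (s - t) *: v) =
    'd F (f t) (f s - f t) - (s - t) *: 'd F (f t) v by rewrite !linearB linearZ.
  by rewrite [RHS]addrA subrK.
apply: le_trans (ler_normD _ _) _; rewrite (splitr e) mulrDl; apply: lerD.
  apply: le_trans h1 _; rewrite -(mulrA (e / 2)) ler_wpM2l//; first lra.
  rewrite ler_pdivrMl// -[f s - f t](subrK ((s - t) *: v)).
  apply: le_trans (ler_normD _ _) _; rewrite normrZ mulrDl mul1r (mulrC `|v|) lerD2r.
  apply: le_trans h2 _; rewrite -[leRHS]mul1r ler_wpM2r// ge_min lexx //.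
apply: le_trans (hk _) _; rewrite mulrC -ler_pdivlMr//.
apply: le_trans h2 _; rewrite -(mulrAC (e / 2)) ler_wpM2r// ge_min lexx orbT //.
Qed.

(** Real induction on the same inequality on [[a, t]] with slope [C + e]. The
    derivative is compared with a fixed vector [v] in order to yield both
    growth estimates ([v = 0]) and differentiability of [f]. *)
Lemma mean_value (V : normedModType R) (f : R -> V) (f' : R -> V) a b v C :
  a <= b -> (forall t, a <= t <= b -> deriv_in `[a, b] f t (f' t)) ->
  (forall t, a <= t <= b -> `|f' t - v| <= C) ->
  `|f b - f a - (b - a) *: v| <= C * (b - a).
Proof.
move=> ab hf hC.
have step t s e : a <= t <= b -> a <= s <= b ->
    `|f s - f t - (s - t) *: f' t| <= e * `|s - t| ->
    `|f s - f t - (s - t) *: v| <= (C + e) * `|s - t|.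
  move=> tab sab h; rewrite -(subrK ((s - t) *: f' t) (f s - f t)) -addrA.
  apply: le_trans (ler_normD _ _) _; rewrite mulrDl (addrC (C * _)) lerD//.
  by rewrite -scalerBr normrZ mulrC ler_wpM2r// hC.
have [->|neab] := eqVneq a b; first by rewrite !subrr scale0r subrr normr0 mulr0.
have ba0 : 0 < b - a by rewrite subr_gt0 lt_neqAle neab.
suff H e : 0 < e -> `|f b - f a - (b - a) *: v| <= (C + e) * (b - a).
  apply/ler_addgt0Pl => e e0; have := H (e / (b - a)) (divr_gt0 e0 ba0).
  by rewrite mulrDl mulfVK ?gt_eqF// (addrC _ e).
move=> e0.
have tri s t u : `|f s - f u - (s - u) *: v| <=
    `|f s - f t - (s - t) *: v| + `|f t - f u - (t - u) *: v|.
  apply: le_trans (ler_normD _ _); rewrite le_eqVlt; apply/orP; left; apply/eqP.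
  congr (`|_|); rewrite addrACA -opprD -scalerDl.
  by congr (_ - _ *: _); [rewrite addrA subrK|rewrite addrA subrK].
apply: (@real_induction a b (fun t => `|f t - f a - (t - a) *: v| <= (C + e) * (t - a))) => //.
- by rewrite !subrr scale0r subrr normr0 mulr0.
- move=> t at_ tb Pt; have tab : a <= t <= b by rewrite at_ ltW.
  have [d d0 hd] := (deriv_inP _ _ _ _).1 (hf t tab) e e0; exists d => // s ts std sb.
  have sab : a <= s <= b by rewrite sb (le_trans at_)// ltW.
  have st0 : 0 < s - t by rewrite subr_gt0.
  have := hd s; rewrite /= in_itv /= gtr0_norm// => /(_ sab).
  have st : s - t < d by lra.
  move=> /(_ st); rewrite -{2}[s - t]gtr0_norm// => /(step _ _ _ tab sab).
  rewrite gtr0_norm// => h; apply: le_trans (tri s t a) _.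
  by apply: le_trans (lerD h Pt) _; rewrite -mulrDr addrA subrK.
- move=> t at_ tb; have tab : a <= t <= b by rewrite tb ltW.
  have [d d0 hd] := (deriv_inP _ _ _ _).1 (hf t tab) e e0; exists d => // s ts st as_ Ps.
  have sab : a <= s <= b by rewrite as_ (le_trans _ tb)// ltW.
  have st0 : 0 < t - s by rewrite subr_gt0.
  have E : `|s - t| = t - s by rewrite distrC gtr0_norm.
  have std : `|s - t| < d by rewrite E; lra.
  have := hd s; rewrite /= in_itv /= => /(_ sab std) /(step _ _ _ tab sab).
  rewrite E => h; apply: le_trans (tri t s a) _.
  have -> : `|f t - f s - (t - s) *: v| = `|f s - f t - (s - t) *: v|.
    by rewrite -normrN opprD opprB -scaleNr opprB.
  apply: le_trans (lerD h Ps) _.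
  by rewrite -mulrDr addrA subrK.
Qed.

Lemma deriv_in0_cst (V : normedModType R) (f : R -> V) :
  (forall t, deriv_in setT f t 0) -> forall t, f t = f 0.
Proof.
have H (g : R -> V) a b : a <= b -> (forall t, deriv_in setT g t 0) -> g b = g a.
  move=> ab hg; apply/eqP; rewrite -subr_eq0 -normr_le0.
  rewrite -[g b - g a]subr0 -(scaler0 _ (b - a)) -(mul0r (b - a)).
  apply: (@mean_value V g (fun=> 0) a b 0 0 ab).
    by move=> t _; apply: deriv_inS (hg t).
  by move=> t _; rewrite subrr normr0.
by move=> hf t; case: (leP 0 t) => [|/ltW] /H ->.
Qed.

End Calc.

(** * Linear and bilinear maps in coordinates *)

Section LinearMaps.
Context {R : realType}.

Lemma linear_eq0 (U V : lmodType R) (f : U -> V) : linear f -> f 0 = 0.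
Proof.
move=> lf; have := lf 1 0 0; rewrite !scale1r addr0 => /eqP.
by rewrite -subr_eq0 opprD addrA subrr sub0r oppr_eq0 => /eqP.
Qed.

Lemma linear_eqD (U V : lmodType R) (f : U -> V) x y :
  linear f -> f (x + y) = f x + f y.
Proof. by move=> lf; have := lf 1 x y; rewrite !scale1r. Qed.

Lemma linear_eqZ (U V : lmodType R) (f : U -> V) a x :
  linear f -> f (a *: x) = a *: f x.
Proof. by move=> lf; have := lf a x 0; rewrite !addr0 linear_eq0// addr0. Qed.

Lemma linear_eqN (U V : lmodType R) (f : U -> V) x :
  linear f -> f (- x) = - f x.
Proof. by move=> lf; rewrite -scaleN1r linear_eqZ// scaleN1r. Qed.

Lemma linear_eqB (U V : lmodType R) (f : U -> V) x y :
  linear f -> f (x - y) = f x - f y.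
Proof. by move=> lf; rewrite linear_eqD// linear_eqN. Qed.

Lemma linear_scale (V : lmodType R) (a : R) : linear (fun x : V => a *: x).
Proof. by move=> b u v; rewrite scalerDr !scalerA mulrC. Qed.

Lemma linear_opp (V : lmodType R) : linear (fun x : V => - x).
Proof. by move=> b u v; rewrite opprD scalerN. Qed.

Lemma coord_le n (x : 'rV[R]_n) j : `|x 0 j| <= `|x|.
Proof.
rewrite [leRHS]/Num.Def.normr /= mx_normrE.
by apply/bigmax_geP; right => /=; exists (0, j).
Qed.

Lemma norm_rV_le n (x : 'rV[R]_n) C : 0 <= C -> (forall j, `|x 0 j| <= C) -> `|x| <= C.
Proof.
move=> C0 h; rewrite [leLHS]/Num.Def.normr /= mx_normrE.
by apply/bigmax_leP; split => // -[i j] _ /=; rewrite ord1.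
Qed.

Lemma linear_eq_sum n (V : lmodType R) (f : 'rV[R]_n -> V) x : linear f ->
  f x = \sum_j x 0 j *: f (basis_vec j).
Proof.
move=> lf; rewrite {1}[x]row_sum_delta.
elim/big_rec2 : _ => [|j b c _ hb]; first exact: linear_eq0.
by rewrite lf hb.
Qed.

Lemma linear_bound n (V : normedModType R) (f : 'rV[R]_n -> V) : linear f ->
  exists2 C, 0 < C & forall x, `|f x| <= C * `|x|.
Proof.
move=> lf; exists (1 + \sum_j `|f (basis_vec j)|).
  by rewrite ltr_wpDr// sumr_ge0.
move=> x; rewrite (linear_eq_sum x lf) mulrDl mul1r.
apply: le_trans (ler_norm_sum _ _ _) _; rewrite -[leLHS]add0r lerD// mulr_suml.
by apply: ler_sum => j _; rewrite normrZ mulrC ler_wpM2l// coord_le.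
Qed.

Lemma deriv_in_linear n (V : normedModType R) (L : 'rV[R]_n -> V) A f t v :
  linear L -> deriv_in A f t v -> deriv_in A (fun s => L (f s)) t (L v).
Proof.
move=> lL [hf]; split=> e e0; have [C C0 hC] := linear_bound lL.
have [d d0 hd] := hf _ (divr_gt0 e0 C0); exists d => // s As /(hd _ As) h.
rewrite -(linear_eqZ _ _ lL) -!(linear_eqB _ _ lL); apply: le_trans (hC _) _.
by rewrite mulrC -ler_pdivlMr// mulrAC.
Qed.

(** Up to a term linear in [f] and one linear in [g], [B (f s) (g s)] is
    [B (f s - f t) (g s - g t)], which is of second order. *)
Lemma deriv_in_bilinear n (V : normedModType R) (B : 'rV[R]_n -> 'rV[R]_n -> V) A f g t v w :
  (forall x, linear (B x)) -> (forall y, linear (B^~ y)) ->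
  deriv_in A f t v -> deriv_in A g t w ->
  deriv_in A (fun s => B (f s) (g s)) t (B v (g t) + B (f t) w).
Proof.
move=> l2 l1 hf hg.
have -> : (fun s => B (f s) (g s)) = (fun s =>
    (B (f s) (g t) + B (f t) (g s)) + (B (f s - f t) (g s - g t) - B (f t) (g t))).
  apply/funext => s; rewrite (linear_eqB _ _ (l1 _)) !(linear_eqB _ _ (l2 _)).
  move: (B (f s) (g s)) (B (f s) (g t)) (B (f t) (g s)) (B (f t) (g t)) => a b c d.
  by rewrite opprB [d - c]addrC (addrA (a - b)) addrK -[a - b - c]addrA -opprD [RHS]addrC subrK.
rewrite -[X in deriv_in _ _ _ X]addr0; apply: deriv_inD.
  by apply: deriv_inD; [exact: (deriv_in_linear (l1 _))|exact: (deriv_in_linear (l2 _))].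
rewrite -[X in deriv_in _ _ _ X]addr0; apply: deriv_inD; last exact: deriv_in_cst.
pose bnd := \sum_j \sum_k `|B (basis_vec j) (basis_vec k)|.
have b0 : 0 <= bnd by rewrite sumr_ge0// => j _; rewrite sumr_ge0.
have hB x y : `|B x y| <= (1 + bnd) * (`|x| * `|y|).
  rewrite (linear_eq_sum x (l1 y)) mulrDl mul1r -[leLHS]add0r lerD ?mulr_ge0//.
  apply: le_trans (ler_norm_sum _ _ _) _; rewrite mulr_suml ler_sum// => j _.
  rewrite (linear_eq_sum y (l2 _)) mulr_suml normrZ.
  apply: le_trans (ler_wpM2l (normr_ge0 _) (ler_norm_sum _ _ _)) _.
  rewrite mulr_sumr ler_sum// => k _; rewrite normrZ [leLHS]mulrA [leLHS]mulrC.
  by rewrite ler_wpM2l// ler_pM// coord_le.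
have [d d0 hd] := (deriv_inP _ _ _ _).1 hf _ ltr01.
have v0 : 0 < 1 + `|v| by rewrite ltr_wpDr.
have c0 : 0 < 1 + bnd by rewrite ltr_wpDr.
split=> e e0; have [d' d'0 hd'] := deriv_in_near hg (divr_gt0 (divr_gt0 e0 c0) v0).
exists (Num.min d d'); first by rewrite lt_min d0.
move=> s As; rewrite lt_min => /andP[/(hd _ As) h1 /(hd' _ As) h2].
rewrite !subrr scaler0 subr0 (linear_eq0 (l2 _)) subr0; apply: le_trans (hB _ _) _.
have h3 : `|f s - f t| <= (1 + `|v|) * `|s - t|.
  rewrite -[f s - f t](subrK ((s - t) *: v)); apply: le_trans (ler_normD _ _) _.
  by rewrite mulrDl normrZ (mulrC `|v|) lerD2r.
rewrite mulrC -ler_pdivlMr//.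
apply: le_trans (ler_pM _ _ h3 (ltW h2)) _ => //.
rewrite le_eqVlt; apply/orP; left; apply/eqP; field.
by rewrite !gt_eqF.
Qed.

End LinearMaps.

(** * Lie groups in exponential coordinates *)

Definition gmulp {R : realType} {n : nat} (G : lie_group R n)
  (p : 'rV[R]_n * 'rV[R]_n) := gmul G p.1 p.2.

(** This definition and the next ones are locked, because comparing
    differentials by unfolding them is very expensive. *)
HB.lock Definition dgmul {R : realType} {n : nat} (G : lie_group R n)
  (x y v w : 'rV[R]_n) : 'rV[R]_n := 'd (gmulp G) (x, y) (v, w).

(** The same vector as [linv G v x], see [linvE]. *)
HB.lock Definition lfield {R : realType} {n : nat} (G : lie_group R n)
  (x v : 'rV[R]_n) : 'rV[R]_n := dgmul G x 0 0 v.

(** In exponential coordinates this is the linear map Ad, see [gconjE]. *)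
HB.lock Definition gconj {R : realType} {n : nat} (G : lie_group R n)
  (x v : 'rV[R]_n) : 'rV[R]_n := gmul G (gmul G x v) (- x).

(** The Lie bracket, see [adE]. As the inversion is the opposite, [lfield (- v) p]
    is the value at [v] of the right invariant field equal to [p] at the
    identity, and the difference is the derivative of the adjoint action, see
    [deriv_in_ad]. *)
HB.lock Definition ad {R : realType} {n : nat} (G : lie_group R n)
  (p v : 'rV[R]_n) : 'rV[R]_n := lfield G (- v) p - lfield G v p.

Section LieGroupTheory.
Context {R : realType} {n : nat} (G : lie_group R n).
Local Notation V := 'rV[R]_n.
Local Notation "x ** y" := (gmul G x y) (at level 40, left associativity).

Local Notation gmulp := (gmulp G).
Local Notation dgmul := (dgmul G).
Local Notation lfield := (lfield G).
Local Notation gconj := (gconj G).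
Local Notation ad := (ad G).

Lemma gmulVg x : - x ** x = 0.
Proof. by have := gmul_exp G x (-1) 1; rewrite scaleN1r scale1r addNr scale0r. Qed.

Lemma gmulgV x : x ** - x = 0.
Proof. by have := gmulVg (- x); rewrite opprK. Qed.

Lemma gmulKg x y : - x ** (x ** y) = y.
Proof. by rewrite gmulA gmulVg gmul0l. Qed.

Lemma gmulKVg x y : x ** (- x ** y) = y.
Proof. by rewrite gmulA gmulgV gmul0l. Qed.

Lemma gmulgK x y : x ** y ** - y = x.
Proof. by rewrite -gmulA gmulgV gmul0r. Qed.

Lemma gmulgKV x y : x ** - y ** y = x.
Proof. by rewrite -gmulA gmulVg gmul0r. Qed.

Lemma gmul_inv x y : - (x ** y) = - y ** - x.
Proof. by rewrite -[RHS](gmulKg (x ** y)) -gmulA gmulKVg gmulgV gmul0r. Qed.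

Lemma gmulp_diff p : differentiable gmulp p.
Proof. by have [] := gmul_smooth G 1%N. Qed.

Lemma deriv_in_gmul A f g t v w : deriv_in A f t v -> deriv_in A g t w ->
  deriv_in A (fun s => f s ** g s) t (dgmul (f t) (g t) v w).
Proof.
move=> hf hg; rewrite dgmul.unlock.
exact: (deriv_in_chain (deriv_in_pair hf hg) (gmulp_diff _)).
Qed.

Lemma dgmul_split x y v w : dgmul x y v w = dgmul x y v 0 + dgmul x y 0 w.
Proof. by rewrite dgmul.unlock -linearD /= -[(v, 0) + (0, w)]/(v + 0, 0 + w) addr0 add0r. Qed.

Lemma dgmul_linearr x y : linear (dgmul x y 0).
Proof.
move=> a u v; rewrite dgmul.unlock -linearP; congr ('d _ _ _).
by rewrite -[RHS]/(a *: 0 + 0, a *: u + v) scaler0 addr0.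
Qed.

Lemma dgmul_linearl x y : linear (fun v => dgmul x y v 0).
Proof.
move=> a u v; rewrite dgmul.unlock -linearP; congr ('d _ _ _).
by rewrite -[RHS]/(a *: u + v, a *: 0 + 0) scaler0 addr0.
Qed.

Lemma lfield_linear x : linear (lfield x).
Proof. rewrite lfield.unlock; exact: dgmul_linearr. Qed.

Lemma deriv_in_line (x w : V) : deriv_in setT (fun s : R => x + s *: w) 0 w.
Proof.
rewrite -[X in deriv_in _ _ _ X]add0r.
by apply: deriv_inD; [exact: deriv_in_cst|exact: deriv_in_scale].
Qed.

Lemma deriv_in_lfield x v : deriv_in setT (fun s => x ** (s *: v)) 0 (lfield x v).
Proof.
have := deriv_in_gmul (deriv_in_cst setT x (0 : R)) (deriv_in_scale setT v (0 : R)).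
by rewrite lfield.unlock scale0r.
Qed.

Lemma dgmul_0r x w : dgmul x 0 w 0 = w.
Proof.
apply: (deriv_in_unique (f := fun s => x + s *: w) (t := 0)); last exact: deriv_in_line.
have := deriv_in_gmul (deriv_in_line x w) (deriv_in_cst setT (0 : V) (0 : R)).
by rewrite scale0r addr0; under eq_fun do rewrite gmul0r.
Qed.

Lemma dgmul_0l x w : dgmul 0 x 0 w = w.
Proof.
apply: (deriv_in_unique (f := fun s => x + s *: w) (t := 0)); last exact: deriv_in_line.
have := deriv_in_gmul (deriv_in_cst setT (0 : V) (0 : R)) (deriv_in_line x w).
by rewrite scale0r addr0; under eq_fun do rewrite gmul0l.
Qed.

Lemma lfield0 v : lfield 0 v = v. Proof. by rewrite lfield.unlock; exact: dgmul_0l. Qed.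

Lemma linvE v x : linv G v x = lfield x v.
Proof.
have dx : differentiable (gmul G x) 0.
  rewrite (_ : gmul G x = gmulp \o (fun y => (x, y))); last by [].
  apply: differentiable_comp; last exact: gmulp_diff.
  apply: differentiable_pair => //; exact: differentiable_cst.
rewrite /linv deriveE//.
apply: (deriv_in_unique (f := fun s : R => gmul G x (s *: v)) (t := 0)); last exact: deriv_in_lfield.
have := @deriv_in_chain R _ _ setT (gmul G x) _ _ _ (deriv_in_scale setT v 0).
by rewrite scale0r => /(_ dx).
Qed.

Lemma lfield_left x p v : dgmul x p 0 (lfield p v) = lfield (x ** p) v.
Proof.
apply: (deriv_in_unique (f := fun s : R => x ** p ** (s *: v)) (t := 0)); last exact: deriv_in_lfield.
have := deriv_in_gmul (deriv_in_cst setT x (0 : R)) (deriv_in_lfield p v).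
by rewrite scale0r gmul0r; under eq_fun do rewrite gmulA.
Qed.

Lemma deriv_in_left A x f t v : deriv_in A f t (lfield (f t) v) ->
  deriv_in A (fun s => x ** f s) t (lfield (x ** f t) v).
Proof.
by move=> hf; have := deriv_in_gmul (deriv_in_cst A x t) hf; rewrite lfield_left.
Qed.

Lemma lfield_ray t v : lfield (t *: v) v = v.
Proof.
apply: (deriv_in_unique (f := fun s : R => t *: v ** (s *: v)) (t := 0)).
  exact: deriv_in_lfield.
by under eq_fun do rewrite gmul_exp scalerDl; exact: deriv_in_line.
Qed.

(** Because [c t ** - (t *: v)] has zero derivative. *)
Lemma integral_curve c v : (forall t, deriv_in setT c t (lfield (c t) v)) ->
  forall t, c t = c 0 ** (t *: v).
Proof.
move=> hc t.
have h s : deriv_in setT (fun s => c s ** - (s *: v)) s 0.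
  have h1 : deriv_in setT (fun s : R => - (s *: v)) s (- v).
    under eq_fun do rewrite -scalerN; exact: deriv_in_scale.
  have := deriv_in_gmul (hc s) h1; rewrite dgmul_split.
  suff -> : dgmul (c s) (- (s *: v)) (lfield (c s) v) 0 = dgmul (c s) (- (s *: v)) 0 v.
    by rewrite -(linear_eqD _ _ (dgmul_linearr _ _)) subrr (linear_eq0 (dgmul_linearr _ _)).
  apply: (deriv_in_unique (f := fun h : R => c s ** (h *: v) ** - (s *: v)) (t := 0)).
    have := deriv_in_gmul (deriv_in_lfield (c s) v) (deriv_in_cst setT (- (s *: v)) (0 : R)).
    by rewrite scale0r gmul0r.
  under eq_fun do rewrite -gmulA -scaleNr gmul_exp addrC scalerDl.
  have := deriv_in_gmul (deriv_in_cst setT (c s) (0 : R)) (deriv_in_line (- s *: v) v).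
  by rewrite scale0r addr0 scaleNr.
have := deriv_in0_cst h t; rewrite scale0r oppr0 gmul0r => <-.
by rewrite gmulgKV.
Qed.

Lemma gconj0 x : gconj x 0 = 0. Proof. by rewrite gconj.unlock gmul0r gmulgV. Qed.

Lemma gconjM x y z : gconj x (y ** z) = gconj x y ** gconj x z.
Proof. by rewrite gconj.unlock !gmulA gmulgKV. Qed.

Lemma gconj_mul x y v : gconj (x ** y) v = gconj x (gconj y v).
Proof. by rewrite gconj.unlock gmul_inv !gmulA. Qed.

Lemma gconj0l v : gconj 0 v = v.
Proof. by rewrite gconj.unlock oppr0 gmul0l gmul0r. Qed.

Lemma gconjK x v : gconj x (gconj (- x) v) = v.
Proof. by rewrite -gconj_mul gmulgV gconj0l. Qed.

Lemma gconjD s t p v : gconj ((s + t) *: p) v = gconj (s *: p) (gconj (t *: p) v).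
Proof. by rewrite -gconj_mul gmul_exp. Qed.

(** The conjugate of a one-parameter subgroup is one, hence a ray, whose value
    at 1 is its initial velocity; and this velocity depends linearly on [v].
    *)
Lemma gconjE x v : gconj x v = dgmul x (- x) (lfield x v) 0.
Proof.
have h0 : deriv_in setT (fun s : R => gconj x (s *: v)) 0 (dgmul x (- x) (lfield x v) 0).
  rewrite gconj.unlock; have := deriv_in_gmul (deriv_in_lfield x v) (deriv_in_cst setT (- x) (0 : R)).
  by rewrite scale0r gmul0r.
have h t : deriv_in setT (fun s : R => gconj x (s *: v)) t
    (lfield (gconj x (t *: v)) (dgmul x (- x) (lfield x v) 0)).
  have h1 : deriv_in setT (fun s : R => gconj x ((- t + 1 * s) *: v)) t
     (1 *: dgmul x (- x) (lfield x v) 0).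
    apply: (@deriv_in_affine R V setT setT (fun s : R => gconj x (s *: v)) t _ (- t) 1) => //.
    by rewrite mul1r addNr.
  have := deriv_in_gmul (deriv_in_cst setT (gconj x (t *: v)) t) h1.
  rewrite mul1r addNr scale0r gconj0 scale1r.
  by rewrite lfield.unlock; under eq_fun do rewrite -gconjM gmul_exp mul1r addrA subrr add0r.
by have := integral_curve h 1; rewrite scale0r gconj0 gmul0l !scale1r.
Qed.

Lemma gconj_linear x : linear (gconj x).
Proof.
move=> a u v; rewrite !gconjE lfield_linear.
exact: dgmul_linearl.
Qed.

Lemma dgmul_Rinv p v : dgmul 0 v p 0 = lfield (- v) p.
Proof.
apply: (deriv_in_unique (f := fun t : R => t *: p ** v) (t := 0)).
  have := deriv_in_gmul (deriv_in_scale setT p (0 : R)) (deriv_in_cst setT v (0 : R)).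
  by rewrite scale0r.
have := deriv_in_linear (@linear_opp R V) (deriv_in_lfield (- v) (- p)).
rewrite (linear_eqN _ (lfield_linear _)) opprK.
by under eq_fun do rewrite gmul_inv scalerN !opprK.
Qed.

(** The argument moves with [h] so that composites of adjoint actions can be
    differentiated as well. *)
Lemma deriv_in_gconj q y y' : deriv_in setT y 0 y' ->
  deriv_in setT (fun h : R => gconj (h *: q) (y h)) 0 (ad q (y 0) + y').
Proof.
move=> hy.
have h1 := deriv_in_gmul (deriv_in_scale setT q (0 : R)) hy.
have h2 : deriv_in setT (fun h : R => - (h *: q)) 0 (- q).
  under eq_fun do rewrite -scalerN; exact: deriv_in_scale.
rewrite gconj.unlock; have := deriv_in_gmul h1 h2.
rewrite scale0r oppr0 gmul0l dgmul_split dgmul_0r dgmul_split dgmul_0l dgmul_Rinv.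
by rewrite (linear_eqN _ (dgmul_linearr _ _)) ad.unlock lfield.unlock addrAC.
Qed.

Lemma deriv_in_ad q v : deriv_in setT (fun h : R => gconj (h *: q) v) 0 (ad q v).
Proof. by have := deriv_in_gconj q (deriv_in_cst setT v 0); rewrite addr0. Qed.

Lemma ad_linearl v : linear (ad^~ v).
Proof.
move=> a p q; rewrite ad.unlock !lfield_linear scalerBr opprD.
by rewrite -!addrA; congr (_ + _); rewrite addrCA.
Qed.

Lemma ad_linearr p : linear (ad p).
Proof.
move=> a v w.
apply: (deriv_in_unique (f := fun h : R => gconj (h *: p) (a *: v + w)) (t := 0)).
  exact: deriv_in_ad.
under eq_fun do rewrite gconj_linear; apply: deriv_inD; last exact: deriv_in_ad.
exact: (deriv_in_linear (@linear_scale R V a) (deriv_in_ad _ _)).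
Qed.

(** The second derivative [b] of the product at the identity is alternating,
    because [lfield (s *: x) x = x] along rays. Hence the derivative
    [- b v p - b v p] of [ad p] along [v] is [b p v - b v p], with no appeal to
    the symmetry of second derivatives. *)
Lemma adE p v : ad p v = bracket G p v.
Proof.
rewrite /bracket /lie_bracket !linvE !lfield0.
have df v1 : differentiable (linv G v1) 0.
  have -> : linv G v1 = (fun q => 'd gmulp q (0, v1)) \o (fun x : V => (x, 0 : V)).
    by apply/funext => x /=; rewrite linvE lfield.unlock dgmul.unlock.
  apply: differentiable_comp.
    by apply: differentiable_pair => //; exact: differentiable_cst.
  by have [_ /(_ (0, v1))[]] := gmul_smooth G 2%N.
rewrite !deriveE//.
pose b x y := 'd (linv G y) 0 x.
have hb x y : deriv_in setT (fun s : R => lfield (s *: x) y) 0 (b x y).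
  have := @deriv_in_chain R _ _ setT (linv G y) _ _ _ (deriv_in_scale setT x 0).
  by rewrite scale0r => /(_ (df y)); under eq_fun do rewrite linvE.
have bl y : linear (b^~ y) by move=> a u w; rewrite /b linearP.
have br x : linear (b x).
  move=> a u w.
  apply: (deriv_in_unique (f := fun s : R => lfield (s *: x) (a *: u + w)) (t := 0)).
    exact: hb.
  under eq_fun do rewrite lfield_linear; apply: deriv_inD; last exact: hb.
  exact: (deriv_in_linear (@linear_scale R V a) (hb _ _)).
(* The ray of [x] is an integral curve of the field of [x]. *)
have bxx x : b x x = 0.
  apply: (deriv_in_unique (f := fun s : R => lfield (s *: x) x) (t := 0)) (hb _ _) _.
  by under eq_fun do rewrite lfield_ray; exact: deriv_in_cst.
have alt x y : b x y = - b y x.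
  have := bxx (x + y); rewrite (linear_eqD _ _ (bl _)) !(linear_eqD _ _ (br _)) !bxx.
  by rewrite add0r addr0 => /eqP; rewrite addr_eq0 => /eqP.
apply: (deriv_in_unique (f := fun s : R => ad p (s *: v)) (t := 0)).
  by under eq_fun do rewrite (linear_eqZ _ _ (ad_linearr _)); exact: deriv_in_scale.
rewrite ad.unlock -[X in deriv_in _ _ _ (X - _)]/(b p v) -[X in deriv_in _ _ _ (_ - X)]/(b v p).
rewrite alt; apply: deriv_inD.
  by rewrite -(linear_eqN _ (bl _)); under eq_fun do rewrite -scalerN; exact: hb.
exact: (deriv_in_linear (@linear_opp R V) (hb _ _)).
Qed.

Lemma auto_lfield (D : V -> V) : linear D -> (forall x y, D (x ** y) = D x ** D y) ->
  forall p v, D (lfield p v) = lfield (D p) (D v).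
Proof.
move=> lD Dm p v.
apply: (deriv_in_unique (f := fun s : R => D p ** (s *: D v)) (t := 0)); last exact: deriv_in_lfield.
have := deriv_in_linear lD (deriv_in_lfield p v).
by under eq_fun do rewrite Dm (linear_eqZ _ _ lD).
Qed.

Lemma gconj_ad x v w : gconj x (ad v w) = ad (gconj x v) (gconj x w).
Proof.
have lc := gconj_linear x.
by rewrite ad.unlock (linear_eqB _ _ lc) !(auto_lfield lc (gconjM x)) (linear_eqN _ lc).
Qed.

(** The derivative at [h = 0] of the identity [gconj_ad], which says that
    conjugations preserve brackets. *)
Lemma jacobi x v w : ad x (ad v w) = ad (ad x v) w + ad v (ad x w).
Proof.
apply: (deriv_in_unique (f := fun h : R => gconj (h *: x) (ad v w)) (t := 0)).
  exact: deriv_in_ad.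
under eq_fun do rewrite gconj_ad.
have := deriv_in_bilinear ad_linearr ad_linearl (deriv_in_ad x v) (deriv_in_ad x w).
by rewrite scale0r !gconj0l.
Qed.

(** The left logarithmic derivative of the map [q |-> t *: q] at [p] in the
    direction [w], that is the Maurer-Cartan form pulled back by the
    exponential map. *)
Definition ray_form (p w : V) (t : R) : V := dgmul (- (t *: p)) (t *: p) 0 (t *: w).

Lemma deriv_in_ray_form p w t :
  deriv_in setT (fun s : R => - (t *: p) ** (t *: (p + s *: w))) 0 (ray_form p w t).
Proof.
have := deriv_in_gmul (deriv_in_cst setT (- (t *: p)) (0 : R))
  (deriv_in_linear (@linear_scale R V t) (deriv_in_line p w)).
by rewrite scale0r addr0.
Qed.

(** A cocycle identity, obtained from the product decomposition of
    [(t + h) *: q] at [q = p + s *: w]. It makes a differential equation for [ray_form]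
    superfluous. *)
Lemma ray_form_add p w t h : ray_form p w (t + h) = gconj (- h *: p) (ray_form p w t) + ray_form p w h.
Proof.
apply: (deriv_in_unique (deriv_in_ray_form p w (t + h))).
have -> : (fun s : R => - ((t + h) *: p) ** ((t + h) *: (p + s *: w))) =
  (fun s : R => gconj (- h *: p) (- (t *: p) ** (t *: (p + s *: w))) **
     (- (h *: p) ** (h *: (p + s *: w)))).
  apply/funext => s.
  rewrite -[(t + h) *: (_ + _)](gmul_exp G) -scaleNr opprD [- t - h]addrC -(gmul_exp G) gconj.unlock.
  by rewrite !gmulA !scaleNr opprK gmulgK.
have := deriv_in_gmul (deriv_in_linear (gconj_linear (- h *: p)) (deriv_in_ray_form p w t))
  (deriv_in_ray_form p w h).
by rewrite scale0r addr0 !gmulVg gconj0 dgmul_split dgmul_0r dgmul_0l.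
Qed.

Lemma ray_form0 p w : ray_form p w 0 = 0.
Proof. by rewrite /ray_form !scale0r (linear_eq0 (dgmul_linearr _ _)). Qed.

Lemma deriv_in_ray_form0 p w : deriv_in setT (ray_form p w) 0 w.
Proof.
pose g (h : R) := dgmul (- (h *: p)) (h *: p) 0 w.
have mcE h : ray_form p w h = h *: g h.
  by rewrite /ray_form /g (linear_eqZ _ _ (dgmul_linearr _ _)).
have cg : forall e, 0 < e -> exists2 d, 0 < d & forall h, `|h| < d -> `|g h - w| < e.
  have [_ /(_ (0, w))[/= dF _]] := gmul_smooth G 2%N.
  have h1 : deriv_in setT (fun h : R => (- (h *: p), h *: p)) 0 (- p, p).
    apply: deriv_in_pair; last exact: deriv_in_scale.
    under eq_fun do rewrite -scalerN; exact: deriv_in_scale.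
  have := deriv_in_near (deriv_in_chain h1 (dF _)).
  rewrite scale0r => H e /H[d d0 hd]; exists d => // h hh.
  have := hd h I; rewrite subr0 => /(_ hh).
  by rewrite -[X in _ -> `|_ - X| < _](dgmul_0l 0) /g dgmul.unlock oppr0.
apply/deriv_inP => e /cg[d d0 hd]; exists d => // h _; rewrite subr0 => /hd hh.
by rewrite ray_form0 subr0 mcE -scalerBr normrZ mulrC ler_wpM2r// ltW.
Qed.

Lemma deriv_in_shift (f : R -> V) t v : deriv_in setT f 0 v ->
  deriv_in setT (fun s => f (s - t)) t v.
Proof.
move=> hf; have := @deriv_in_affine R V setT setT f t v (- t) 1 (fun _ _ => I).
rewrite mul1r addNr scale1r => /(_ hf).
by under eq_fun do rewrite mul1r addrC.
Qed.

(** Such a map intertwines successively the adjoint actions (both sides solve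
    the same linear equation along rays), the forms [ray_form] (by their cocycle
    identity), the left invariant fields (which [ray_form] inverts), and the
    integral curves of these fields, which determine the product. *)
Lemma bracket_auto (D : V -> V) : linear D ->
  (forall x y, D (ad x y) = ad (D x) (D y)) ->
  forall x y, D (x ** y) = D x ** D y.
Proof.
move=> lD Dad.
(* Both sides agree at the identity and evolve equally along [t *: p]. *)
have Dgconj p v : D (gconj p v) = gconj (D p) (D v).
  pose q := D p; pose f t := gconj (- t *: q) (D (gconj (t *: p) v)).
  have hf t : deriv_in setT f t 0.
    pose w := gconj (t *: p) v.
    have h0 : deriv_in setT (fun h : R => gconj (h *: - q) (D (gconj (h *: p) w))) 0 0.
      have := deriv_in_gconj (- q) (deriv_in_linear lD (deriv_in_ad p w)).
      by rewrite scale0r gconj0l (linear_eqN _ (ad_linearl _)) Dad -/q addNr.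
    have := deriv_in_linear (gconj_linear (- t *: q)) (deriv_in_shift t h0).
    rewrite gconj0; congr (deriv_in _ _ _ _); apply/funext => s.
    by rewrite /f scalerN -scaleNr -gconjD /w -gconjD subrK opprB addKr.
  have := deriv_in0_cst hf 1; rewrite /f !scale0r oppr0 scale0r !gconj0l !scale1r scaleN1r.
  by move=> <-; rewrite gconjK.
(* The defect [K] of the intertwining is again a cocycle, with zero derivative at 0. *)
have Dmc p w t : D (ray_form p w t) = ray_form (D p) (D w) t.
  pose q := D p; pose K t := D (ray_form p w t) - ray_form q (D w) t.
  have Kadd s h : K (s + h) = gconj (- h *: q) (K s) + K h.
    rewrite /K !ray_form_add (linear_eqD _ _ lD) Dgconj (linear_eqZ _ _ lD) -/q.
    by rewrite (linear_eqB _ _ (gconj_linear _)) opprD addrACA.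
  have K0 : K 0 = 0 by rewrite /K !ray_form0 (linear_eq0 lD) subr0.
  have hK : deriv_in setT K 0 0.
    rewrite -(subrr (D w)); apply: deriv_inD; first exact: (deriv_in_linear lD (deriv_in_ray_form0 _ _)).
    exact: (deriv_in_linear (@linear_opp R V) (deriv_in_ray_form0 _ _)).
  pose E t := gconj (t *: q) (K t).
  have hE s : deriv_in setT E s 0.
    have h0 := deriv_in_gconj q hK.
    rewrite K0 addr0 (linear_eq0 (ad_linearr _)) in h0.
    have := deriv_in_linear (gconj_linear (s *: q)) (deriv_in_shift s h0).
    rewrite gconj0 => /(deriv_inD (deriv_in_cst setT (E s) s)); rewrite addr0.
    congr (deriv_in _ _ _ _); apply/funext => u; rewrite /E -gconjD.
    have Eu : u = s + (u - s) by rewrite addrC subrK.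
    rewrite [in RHS]Eu (Kadd s (u - s)); move: (K s) (K (u - s)) => a b.
    rewrite (linear_eqD _ _ (gconj_linear _)) -gconjD.
    by congr (gconj (_ *: _) _ + _); ring.
  have := deriv_in0_cst hE t; rewrite /E K0 gconj0 => h.
  apply/eqP; rewrite -subr_eq0 -/q -/(K t); apply/eqP.
  by rewrite -(gconjK (- (t *: q)) (K t)) opprK h gconj0.
have DL p v : D (lfield p v) = lfield (D p) (D v).
  have hmc x w : ray_form x w 1 = dgmul (- x) x 0 w by rewrite /ray_form !scale1r.
  have := Dmc p (lfield p v) 1; rewrite !hmc lfield_left gmulVg lfield0 => ->.
  set z := D (lfield p v); set q := D p; rewrite lfield.unlock -[X in dgmul _ X _ _](gmulVg q).
  apply: (deriv_in_unique (f := fun s : R => q + s *: z) (t := 0)); first exact: deriv_in_line.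
  have := deriv_in_gmul (deriv_in_cst setT q (0 : R))
    (deriv_in_gmul (deriv_in_cst setT (- q) (0 : R)) (deriv_in_line q z)).
  by rewrite scale0r addr0; under eq_fun do rewrite gmulKVg.
move=> x y.
have h t : deriv_in setT (fun t : R => D (x ** (t *: y))) t (lfield (D (x ** (t *: y))) (D y)).
  rewrite -DL; apply: (deriv_in_linear lD); apply: deriv_in_left.
  by rewrite lfield_ray; exact: deriv_in_scale.
by have := integral_curve h 1; rewrite scale0r gmul0r !scale1r.
Qed.

End LieGroupTheory.

(** * Dilations of a Carnot group *)

(** Turns a linear equation into a subspace, so that the spanning properties
    of the layers apply to it. *)
Lemma ker_vspace (R : realType) n k (f : 'rV[R]_n -> 'rV[R]_k) : linear f ->
  exists U : {vspace 'rV[R]_n}, forall x, (x \in U) = (f x == 0).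
Proof.
move=> lf; pose M := \matrix_(i < n) f (basis_vec i).
exists (lker (linfun (mulmxr M))) => x; rewrite memv_ker lfunE /= mulmx_sum_row.
rewrite (linear_eq_sum x lf); congr (_ == 0).
by apply: eq_bigr => i _; rewrite rowK.
Qed.

Section Dilations.
Context {R : realType} {r m : nat} (G : carnot_group R r m).
Local Notation n := (r + m)%N.
Local Notation V := 'rV[R]_n.
Local Notation "x ** y" := (gmul G x y) (at level 40, left associativity).

Lemma layers_span k (f : V -> 'rV[R]_k) : linear f ->
  (forall i x, (1 <= i <= step G)%N -> x \in layer G i -> f x = 0) ->
  forall x, f x = 0.
Proof.
move=> lf h x; have [U hU] := ker_vspace lf.
have : (fullv <= U)%VS.
  rewrite -(layer_sum G); apply/subv_sumP => i _; apply/subvP => y yi.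
  by rewrite hU (h i.+1 y)//= ltn_ord.
by move=> /subvP/(_ x (memvf _)); rewrite hU => /eqP.
Qed.

Lemma basis_vec_neq0 (j : 'I_n) : basis_vec j != 0 :> V.
Proof.
apply/eqP => /rowP/(_ j); rewrite /basis_vec !mxE !eqxx /= => /eqP.
by rewrite oner_eq0.
Qed.

(** Otherwise the coordinate of index [j] would vanish on every layer, hence
    everywhere. *)
Lemma weight_ex (j : 'I_n) :
  exists i, ((1 <= i <= step G)%N && (basis_vec j \in layer G i)).
Proof.
apply: contrapT => h.
pose f (x : V) := x *m (delta_mx j 0 : 'cV[R]_n).
have lf : linear f by move=> a u v; rewrite /f mulmxDl scalemxAl.
have : f (basis_vec j) = 0.
  apply: layers_span => // i x i1; rewrite layer_adapted//.
  have [U hU] := ker_vspace lf.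
  suff : (<<[seq basis_vec j0 | j0 <- enum 'I_n & basis_vec j0 \in layer G i]>> <= U)%VS.
    by move=> /subvP sU /sU; rewrite hU => /eqP.
  apply/span_subvP => y /mapP[k]; rewrite mem_filter => /andP[ki _] ->.
  rewrite hU /f /basis_vec mul_delta_mx_0//.
  apply: contra_not_neq h => <-; by exists i; rewrite i1.
rewrite /f /basis_vec mul_delta_mx => /matrixP/(_ 0 0); rewrite !mxE !eqxx /= => /eqP.
by rewrite oner_eq0.
Qed.

Definition weight (j : 'I_n) : nat := sval (cid (weight_ex j)).

Lemma weightP j : (1 <= weight j <= step G)%N /\ basis_vec j \in layer G (weight j).
Proof. by rewrite /weight; case: (cid _) => i /= /andP[]. Qed.

Lemma weight_eq j i : (1 <= i <= step G)%N -> basis_vec j \in layer G i -> weight j = i.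
Proof.
move=> i1 ji; have [w1 jw] := weightP j; apply/eqP; apply: contraT => wi.
case: i i1 ji wi => // i /= i1 ji wi.
move: w1 jw wi; case: (weight j) => // w /= w1 jw wi.
have /directv_sumP/(_ (Ordinal i1) isT)/= := layer_direct G.
move=> h; have : basis_vec j \in (layer G i.+1 :&:
    \sum_(j0 < step G | j0 != Ordinal i1) layer G j0.+1)%VS.
  rewrite memv_cap ji /=; apply: (subvP (sumv_sup (Ordinal w1) _ (subvv _))) => //.
by rewrite h memv0 (negPf (basis_vec_neq0 j)).
Qed.

(** The ratio may be any real number: the ratio [-1] serves to reverse time,
    see [connects_near_rev]. *)
Definition dil (l : R) (x : V) : V := \row_j (l ^+ weight j * x 0 j).

Lemma dil_linear l : linear (dil l).
Proof. by move=> a u v; apply/rowP => j; rewrite !mxE mulrDr mulrCA. Qed.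

Lemma dil_layer l i x : (1 <= i <= step G)%N -> x \in layer G i ->
  dil l x = l ^+ i *: x.
Proof.
move=> i1; rewrite layer_adapted// => xi.
pose f x := dil l x - l ^+ i *: x.
have lf : linear f.
  move=> a u v; rewrite /f dil_linear scalerDr scalerBr opprD addrACA !scalerA.
  by rewrite (mulrC a).
have [U hU] := ker_vspace lf.
suff : (<<[seq basis_vec j0 | j0 <- enum 'I_n & basis_vec j0 \in layer G i]>> <= U)%VS.
  by move=> /subvP/(_ x xi); rewrite hU subr_eq0 => /eqP.
apply/span_subvP => y /mapP[k]; rewrite mem_filter => /andP[ki _] ->.
rewrite hU subr_eq0; apply/eqP/rowP => j; rewrite !mxE /=.
by case: eqVneq => [->|_]; rewrite ?mulr0// (weight_eq i1 ki).
Qed.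

(** For [x] in the first layer this is the grading of the bracket. The vectors
    [x] for which it holds for all [y] are closed under brackets by the Jacobi
    identity, and the first layer generates the others. *)
Lemma dil_ad l x y : dil l (ad G x y) = ad G (dil l x) (dil l y).
Proof.
have lD := dil_linear l.
have lfr x1 : linear (fun y => dil l (ad G x1 y) - ad G (dil l x1) (dil l y)).
  move=> a u v; rewrite ad_linearr !lD ad_linearr.
  by rewrite scalerBr opprD addrACA.
have lfl y1 : linear (fun x => dil l (ad G x y1) - ad G (dil l x) (dil l y1)).
  move=> a u v; rewrite (ad_linearl G y1) !lD (ad_linearl G (dil l y1)).
  by rewrite scalerBr opprD addrACA.
suff H i z : (1 <= i.+1 <= step G)%N -> z \in layer G i.+1 ->
    forall y, dil l (ad G z y) = ad G (dil l z) (dil l y).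
  apply/eqP; rewrite -subr_eq0; apply/eqP.
  apply: (layers_span (lfl y)) => -[//|i] z i1 zi.
  by apply/eqP; rewrite subr_eq0; apply/eqP; exact: H zi y.
elim: i z {x y} => [|i IH] z i1 zi y.
  apply/eqP; rewrite -subr_eq0; apply/eqP; apply: (layers_span (lfr z)) => k x k1 xk.
  apply/eqP; rewrite subr_eq0; apply/eqP.
  rewrite (dil_layer l i1 zi) (dil_layer l k1 xk).
  rewrite (linear_eqZ _ _ (ad_linearr _ _)) (linear_eqZ _ _ (ad_linearl _ _)).
  case/andP: k1 => k1; rewrite leq_eqVlt => /predU1P[ks|ks].
    rewrite adE (layer_bracket_last zi) ?(linear_eq0 lD) ?scaler0// -ks//.
  have k2 : (2 <= k.+1 <= step G)%N by rewrite ltnS k1.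
  have [/(_ z x zi xk) h _] := layer_bracket k2.
  by rewrite -adE in h; rewrite (@dil_layer l k.+1)// exprS scalerA mulrC.
have i2 : (2 <= i.+2 <= step G)%N by case/andP: i1.
have [U hU] := ker_vspace (lfl y).
have [_ /(_ U) h] := layer_bracket i2.
suff : (layer G i.+2 <= U)%VS by move=> /subvP/(_ z zi); rewrite hU subr_eq0 => /eqP.
apply: h => x1 x2 h1 h2; rewrite hU subr_eq0; apply/eqP; rewrite -adE.
have i1' : (1 <= i.+1 <= step G)%N by case/andP: i2 => _ /ltnW.
have D1 y1 : dil l (ad G x1 y1) = ad G (dil l x1) (dil l y1).
  apply/eqP; rewrite -subr_eq0; apply/eqP; apply: (layers_span (lfr x1)) => k x k1 xk.
  apply/eqP; rewrite subr_eq0; apply/eqP.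
  have s1 : (1 <= 1 <= step G)%N by rewrite step_gt0.
  rewrite (dil_layer l s1 h1) (dil_layer l k1 xk).
  rewrite (linear_eqZ _ _ (ad_linearr _ _)) (linear_eqZ _ _ (ad_linearl _ _)).
  case/andP: k1 => k1; rewrite leq_eqVlt => /predU1P[ks|ks].
    rewrite adE (layer_bracket_last h1) ?(linear_eq0 lD) ?scaler0// -ks//.
  have k2 : (2 <= k.+1 <= step G)%N by rewrite ltnS k1.
  have [/(_ x1 x h1 xk) h' _] := layer_bracket k2.
  by rewrite -adE in h'; rewrite (@dil_layer l k.+1)// exprS scalerA mulrC.
have J a b c : ad G (ad G a b) c = ad G a (ad G b c) - ad G b (ad G a c).
  by rewrite jacobi addrK.
by rewrite !J (linear_eqB _ _ lD) !D1 !(IH x2 i1' h2) !D1 J.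
Qed.

Lemma dilM l x y : dil l (x ** y) = dil l x ** dil l y.
Proof. exact: (bracket_auto (dil_linear l) (dil_ad l)). Qed.

Lemma dil_dil a b x : dil a (dil b x) = dil (a * b) x.
Proof. by apply/rowP => j; rewrite !mxE exprMn mulrA. Qed.

Lemma dil1 x : dil 1 x = x.
Proof. by apply/rowP => j; rewrite !mxE expr1n mul1r. Qed.

Lemma dilK a x : a != 0 -> dil a^-1 (dil a x) = x.
Proof. by move=> a0; rewrite dil_dil mulVf// dil1. Qed.

Lemma dil_hor l (u : 'rV[R]_r) : dil l (hor u : V) = l *: hor u.
Proof.
apply/rowP => j; rewrite !mxE; case: (split_ordP j) => k -> /=; last first.
  by rewrite mxE !mulr0.
congr (_ * _); rewrite -[RHS]expr1; congr (_ ^+ _); apply: weight_eq.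
  by rewrite step_gt0.
by rewrite layer1P /=.
Qed.

(** All weights are at least 1. *)
Lemma dil_norm l x : 0 <= l <= 1 -> `|dil l x| <= l * `|x|.
Proof.
move=> /andP[l0 l1]; apply: norm_rV_le => [|j]; first by rewrite mulr_ge0.
rewrite mxE normrM ler_pM// ?coord_le// normrX ger0_norm//.
have [/andP[]] := weightP j; case: (weight j) => // k _ _ _.
by rewrite exprS -[leRHS]mulr1 ler_wpM2l// exprn_ile1.
Qed.

Lemma dil_lfield l p v : dil l (lfield G p v) = lfield G (dil l p) (dil l v).
Proof. exact: (auto_lfield (dil_linear l) (dilM l)). Qed.

End Dilations.

(** * Absolutely continuous curves *)

Section AbsolutelyContinuous.
Context {R : realType}.
Local Notation mu := (@lebesgue_measure R).

(** [S] is a sum of increments of [phi] over disjoint intervals between [a]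
    and [t] whose total length is at most the measure of the part of [O]
    before [t]. Cutting [O] at [t] is what allows an interval contained in [O]
    to be added on the right. *)
Definition increment_family {W : normedModType R} (phi : R -> W) (O : set R)
    (a t S : R) : Prop :=
  exists (k : nat) (c d : 'I_k -> R),
    [/\ forall i, a <= c i /\ c i < d i /\ d i <= t,
        forall i j, i != j -> d i <= c j \/ d j <= c i,
        ((\sum_(i < k) (d i - c i))%:E <= mu (O `&` `[a, t[))%E &
        S = \sum_(i < k) `|phi (d i) - phi (c i)|].

Lemma increment_family0 (W : normedModType R) (phi : R -> W) O a t :
  increment_family phi O a t 0.
Proof.
exists 0%N, (fun=> 0), (fun=> 0); split => [[]//|[]//||].
  by rewrite big_ord0 measure_ge0.
by rewrite big_ord0.
Qed.

Lemma increment_familyS (W : normedModType R) (phi : R -> W) (O : set R) (a s t S : R) :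
  measurable O -> s <= t -> increment_family phi O a s S -> increment_family phi O a t S.
Proof.
move=> mO st [k [c [d [h1 h2 h3 h4]]]]; exists k, c, d; split => //.
  by move=> i; have [? [? ?]] := h1 i; do 2 split => //; apply: le_trans st.
apply: le_trans h3 _; apply: le_measure; rewrite ?inE; try exact: measurableI.
apply: setIS => x /=; rewrite !in_itv /= => /andP[-> xs] /=; exact: lt_le_trans st.
Qed.

Lemma increment_family_add (W : normedModType R) (phi : R -> W) (O : set R) (a s t S : R) :
  measurable O -> a <= s -> s < t -> `[s, t[ `<=` O -> increment_family phi O a s S ->
  increment_family phi O a t (S + `|phi t - phi s|).
Proof.
move=> mO as_ st sO [k [c [d [h1 h2 h3 h4]]]].
exists k.+1, (fun i => if unlift ord0 i is Some j then c j else s),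
  (fun i => if unlift ord0 i is Some j then d j else t); split.
- move=> i; case: unliftP => [j _|_]; last by [].
  by have [? [? ?]] := h1 j; do 2 split => //; apply: le_trans (ltW st).
- move=> i j; case: unliftP => [i' ->|->]; case: unliftP => [j' ->|->].
  + by rewrite (inj_eq lift_inj); exact: h2.
  + by move=> _; left; have [? [? ?]] := h1 i'.
  + by move=> _; right; have [? [? ?]] := h1 j'.
  + by rewrite eqxx.
- rewrite big_ord_recl /= unlift_none.
  under eq_bigr do rewrite liftK.
  apply: (@le_trans _ _ (mu ((O `&` `[a, s[) `|` `[s, t[))).
    rewrite measureU//; last first.
    + apply/seteqP; split => x //= [[_]]; rewrite !in_itv /= => /andP[_ xs] /andP[sx _].
      by move: (lt_le_trans xs sx); rewrite ltxx.
    + exact: measurableI.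
    rewrite addrC EFinD; apply: leeD => //.
    suff : ((t - s)%:E <= mu `[s, t[%classic)%E by [].
    by rewrite lebesgue_measure_itv /= lte_fin st EFinB.
  apply: le_measure; rewrite ?inE; [|exact: measurableI|].
    by apply: measurableU => //; exact: measurableI.
  move=> x /= [[Ox]|]; rewrite !in_itv /= => /andP[sx xs].
    by split => //; rewrite sx (lt_trans xs st).
  split; last by rewrite xs (le_trans as_ sx).
  by apply: sO; rewrite /= in_itv /= sx.
- rewrite big_ord_recl /= unlift_none addrC h4; congr (_ + _).
  by apply: eq_bigr => i _; rewrite liftK.
Qed.

(** Real induction on the inequality
    [`|phi t - phi a| <= H t - H a + e * (t - a) + S], where [S] is a sum of
    increments over intervals of an open set [U] of small measure containing
    the exceptional null set. A step next to an exceptional point is absorbed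
    by [S], any other step by the local domination; in the end absolute
    continuity bounds [S] by [e]. *)
Lemma ac_increment (W : normedModType R) (a b : R) (phi : R -> W) (H : R -> R) :
  a <= b -> abs_continuous a b phi ->
  (forall s t, a <= s -> s <= t -> t <= b -> H s <= H t) ->
  {ae mu, forall t, t \in `]a, b[ -> forall e, 0 < e -> exists2 d, 0 < d &
     forall s, a <= s <= b -> `|s - t| < d ->
       `|phi s - phi t| <= `|H s - H t| + e * `|s - t|} ->
  `|phi b - phi a| <= H b - H a.
Proof.
move=> ab AC Hnd [N [mN N0 hN]].
have ba1 : 0 < 1 + (b - a) by lra.
suff main e : 0 < e -> `|phi b - phi a| <= H b - H a + e * (1 + (b - a)).
  apply/ler_addgt0Pr => e e0; have := main _ (divr_gt0 e0 ba1).
  by rewrite mulfVK// gt_eqF.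
move=> e0; have [d d0 hd] := AC e e0.
(* The hypothesis does not cover the endpoints, which join the exceptional set. *)
pose N' := N `|` ([set a] `|` [set b]).
have mN' : measurable N' by apply: measurableU => //; apply: measurableU.
have N'0 : mu N' = 0%E.
  apply/eqP; rewrite eq_le measure_ge0 andbT.
  apply: le_trans (measureU2 _ _ _) _ => //; first exact: measurableU.
  rewrite -[X in (X + _)%E]/(mu N) N0 add0e; apply: le_trans (measureU2 _ _ _) _ => //.
  suff : (mu [set a] + mu [set b] <= 0)%E by [].
  by rewrite !lebesgue_measure_set1 adde0.
have N'y : (mu N' < +oo)%E by rewrite N'0.
have [U [opU NU Ud]] := lebesgue_regularity_outer mN' N'y d0.
have mU : measurable U by exact: open_measurable.
have muU : (mu U < d%:E)%E.
  rewrite -(setDUK NU); apply: le_lt_trans (measureU2 _ _ _) _ => //.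
    exact: measurableD.
  by rewrite -[X in (X + _)%E]/(mu N') N'0 add0e.
pose P t := exists2 S, increment_family phi U a t S &
  `|phi t - phi a| <= H t - H a + e * (t - a) + S.
have tri s t : `|phi t - phi a| <= `|phi s - phi a| + `|phi t - phi s|.
  by rewrite [leRHS]addrC; apply: le_trans (ler_normD _ _); rewrite addrA subrK.
have ext1 s t : a <= s -> s < t -> t <= b -> `[s, t[ `<=` U -> P s -> P t.
  move=> as_ st tb sU [S fS hS]; exists (S + `|phi t - phi s|).
    exact: increment_family_add fS.
  apply: le_trans (tri s t) _; rewrite addrA lerD2r; apply: le_trans hS _.
  rewrite lerD2r; apply: lerD; first by rewrite lerD2r Hnd// ltW.
  by rewrite ler_wpM2l ?lerD2r// ltW.
have ext2 s t : a <= s -> s < t -> t <= b ->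
    `|phi t - phi s| <= `|H t - H s| + e * `|t - s| -> P s -> P t.
  move=> as_ st tb h [S fS hS]; exists S; first exact: increment_familyS (ltW st) fS.
  apply: le_trans (tri s t) _; apply: le_trans (lerD hS h) _.
  have := Hnd s t as_ (ltW st) tb; rewrite -subr_ge0 => Hst.
  rewrite (ger0_norm Hst) ger0_norm ?subr_ge0 ?(ltW st)//.
  by rewrite le_eqVlt; apply/orP; left; apply/eqP; ring.
have Onb t : U t -> exists2 d1, 0 < d1 & forall s, `|s - t| < d1 -> U s.
  move=> Ot; have /nbhs_ballP[d1 /= d10 hd1] := open_nbhs_nbhs (conj opU Ot).
  by exists d1 => // s st; apply: hd1; rewrite /ball /= distrC.
have dom t : a <= t <= b -> ~ N' t -> exists2 d1, 0 < d1 & forall s, a <= s <= b ->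
    `|s - t| < d1 -> `|phi s - phi t| <= `|H s - H t| + e * `|s - t|.
  move=> /andP[at_ tb] nt; have tab : t \in `]a, b[.
    rewrite in_itv /= !lt_neqAle at_ tb !andbT; apply/andP.
    by split; apply/eqP => E; apply: nt; right; [left|right].
  by apply: contrapT => h; apply: nt; left; apply: hN => /= /(_ tab e e0).
have : P b.
  apply: (@real_induction R a b P) => //.
  - by exists 0; [exact: increment_family0|rewrite !subrr normr0 mulr0 !addr0].
  - move=> t at_ tb Pt; have tab : a <= t <= b by rewrite at_ ltW.
    have [Nt|Nt] := pselect (N' t).
      have [d1 d10 hd1] := Onb t (NU _ Nt); exists d1 => // s ts std sb.
      apply: (ext1 t s) => // x; rewrite /= in_itv /= => /andP[tx xs].
      by apply: hd1; rewrite ger0_norm ?subr_ge0//; lra.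
    have [d1 d10 hd1] := dom t tab Nt; exists d1 => // s ts std sb.
    apply: (ext2 t s) => //; apply: hd1; first by rewrite sb (le_trans at_)// ltW.
    by rewrite gtr0_norm ?subr_gt0//; lra.
  - move=> t at_ tb; have tab : a <= t <= b by rewrite tb ltW.
    have [Nt|Nt] := pselect (N' t).
      have [d1 d10 hd1] := Onb t (NU _ Nt); exists d1 => // s ts std as_ Ps.
      apply: (ext1 s t) => // x; rewrite /= in_itv /= => /andP[sx xt].
      by apply: hd1; rewrite distrC gtr0_norm ?subr_gt0//; lra.
    have [d1 d10 hd1] := dom t tab Nt; exists d1 => // s ts std as_ Ps.
    apply: (ext2 s t) => //; rewrite distrC [`|H t - H s|]distrC [`|t - s|]distrC.
    apply: hd1; first by rewrite as_ (le_trans (ltW std)).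
    by rewrite distrC gtr0_norm ?subr_gt0//; lra.
move=> [S [k [c [d1 [h1 h2 h3 ->]]]] hS].
apply: le_trans hS _; rewrite (_ : e * (1 + (b - a)) = e * (b - a) + e); last by ring.
rewrite addrA lerD2l ltW//.
apply: hd => //; rewrite -lte_fin; apply: le_lt_trans h3 _; apply: le_lt_trans muU.
apply: le_measure; rewrite ?inE//; exact: measurableI.
Qed.

Lemma ac_cont (W : normedModType R) (a b : R) (phi : R -> W) : abs_continuous a b phi ->
  forall e, 0 < e -> exists2 d, 0 < d & forall s t, a <= s <= b -> a <= t <= b ->
    `|s - t| < d -> `|phi s - phi t| < e.
Proof.
move=> AC e e0; have [d d0 hd] := AC e e0; exists d => //.
have H s t : a <= s -> s < t -> t <= b -> t - s < d -> `|phi t - phi s| < e.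
  move=> as_ st tb std; have := hd 1%N (fun=> s) (fun=> t).
  rewrite !big_ord1; apply => // i j; by rewrite !ord1 eqxx.
move=> s t /andP[as_ sb] /andP[at_ tb]; case: (ltgtP s t) => st.
- rewrite distrC gtr0_norm ?subr_gt0// => h; rewrite distrC; exact: H.
- rewrite gtr0_norm ?subr_gt0// => h; exact: H.
- by rewrite st subrr normr0 => _; rewrite subrr normr0.
Qed.

Lemma ac_bounded (W : normedModType R) (a b : R) (phi : R -> W) : a <= b ->
  abs_continuous a b phi -> exists B, forall t, a <= t <= b -> `|phi t| <= B.
Proof.
move=> ab AC; have [d d0 hd] := ac_cont AC ltr01.
have d20 : 0 < d / 2 by lra.
pose P t := exists B, forall s, a <= s <= t -> `|phi s| <= B.
have step s t : a <= s -> s < t -> t <= b -> t - s < d -> P s -> P t.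
  move=> as_ st tb std [B hB]; exists (B + 1) => x /andP[ax xt].
  have [xs|sx] := leP x s; first by apply: le_trans (hB x _) _; rewrite ?ax// lerDl.
  rewrite -[phi x](subrK (phi s)) addrC (le_trans (ler_normD _ _))//.
  apply: lerD; first by apply: hB; rewrite as_ lexx.
  apply/ltW/hd; rewrite ?(le_trans as_ (ltW sx)) ?as_ ?(le_trans xt tb)//=.
    by rewrite (le_trans (ltW st) tb).
  by rewrite gtr0_norm ?subr_gt0//; lra.
apply: (@real_induction R a b P) => //.
- by exists `|phi a| => s; rewrite -eq_le => /eqP <-.
- move=> t at_ tb Pt; exists d => // s ts std sb; apply: (step t s) => //; lra.
- move=> t at_ tb; exists d => // s ts st as_ Ps; apply: (step s t) => //; lra.
Qed.

End AbsolutelyContinuous.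

Section Primitive.
Context {R : realType}.
Local Notation mu := (@lebesgue_measure R).

(** The integral of [h] extended by 0 outside of the segment; it is
    differentiable at almost every point by Lebesgue's theorem. *)
Lemma primitive_exists (a b L : R) (h : R -> R) :
  (forall t, 0 <= h t) -> measurable_fun `[a, b]%classic h ->
  (\int[mu]_(t in `[a, b]) (h t)%:E < L%:E)%E ->
  exists F : R -> R^o, [/\ forall s t, s <= t -> F s <= F t, forall s, 0 <= F s,
    forall s, s <= b -> F s <= L &
    {ae mu, forall t, t \in `]a, b[ -> deriv_in setT F t (h t)}].
Proof.
move=> h0 mh lenL; pose D := `[a, b]%classic : set R.
have mD : measurable D by exact: measurable_itv.
have lfin : (\int[mu]_(x in D) (h x)%:E < +oo)%E.
  by apply: lt_le_trans lenL _; rewrite leey.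
have hint : mu.-integrable D (EFin \o h).
  apply/integrableP; split; first exact/measurable_EFinP.
  suff -> : (\int[mu]_(x in D) `|(EFin \o h) x| = \int[mu]_(x in D) (h x)%:E)%E by [].
  by apply: eq_integral => y _ /=; rewrite ger0_norm.
pose f := h \_ D.
have f0 t : 0 <= f t by rewrite /f patchE; case: ifP.
have fint : mu.-integrable setT (EFin \o f).
  by have := hint; rewrite integrable_mkcond//= restrict_EFin.
pose F s := (\int[mu]_(t in [set` Interval (BLeft a) (BRight s)]) (f t))%R.
have Ffin s : (\int[mu]_(t in `[a, s]) (f t)%:E)%E \is a fin_num.
  by apply: integrable_fin_num => //; apply: integrableS fint.
have Fnd s t : s <= t -> F s <= F t.
  move=> st; apply: fine_le; [exact: Ffin|exact: Ffin|].
  apply: ge0_subset_integral => //.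
  - by apply: measurable_funTS; case/integrableP: fint.
  - by move=> y _; rewrite lee_fin.
  - by apply: subset_itvl; rewrite bnd_simp.
have FL s : s <= b -> F s <= L.
  move=> sb; apply: le_trans (Fnd _ _ sb) _.
  rewrite -lee_fin fineK; last exact: Ffin.
  apply: le_trans (ltW lenL); rewrite le_eqVlt; apply/orP; left; apply/eqP.
  by apply: eq_integral => y yD; rewrite /f patchE yD.
have Fa0 s : 0 <= F s by apply: Rintegral_ge0 => // y _.
have fy y : mu.-integrable [set` Interval (BLeft a) (BRight y)] (EFin \o f).
  by apply: integrableS fint.
have Fder := FTC1 fy (integrable_locally mD hint).
exists F; split => //.
move: Fder; apply: filterS; first exact: (ae_filter_ringOfSetsType mu).
move=> t hF; rewrite in_itv /= => /andP[at_ tb]; have [dF F'] := hF at_.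
have -> : h t = f t by rewrite /f patchE mem_set// /D /= in_itv /= !ltW.
by apply: is_derive_deriv_in; apply: DeriveDef; [exact: dF|rewrite -derive1E; exact: F'].
Qed.

End Primitive.

(** * Bounds on balls *)

Section Bounds.
Context {R : realType}.

Lemma continuous_bounded_ball n (W : normedModType R) (f : 'rV[R]_n -> W) :
  continuous f -> forall B, exists2 K, 0 < K & forall z, `|z| <= B -> `|f z| <= K.
Proof.
move=> cf B; pose A := closed_ball_ Num.Def.normr (0 : 'rV[R]_n) B.
have cA : compact A.
  apply: bounded_closed_compact; last exact: closed_closed_ball_.
  exists B; split => [|M BM z]; first exact: num_real.
  by rewrite /A /closed_ball_ /= sub0r normrN => /le_trans; apply; exact: ltW.
have : compact [set f x | x in A].
  by apply: continuous_compact => //; apply: continuous_subspaceT.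
move=> /compact_bounded[M [Mr hM]].
exists (Num.max (M + 1) 1); first by rewrite lt_max ltr01 orbT.
move=> z zB; apply: (le_trans (hM (M + 1) _ _ _)); first by rewrite ltrDl.
  by exists z => //; rewrite /A /closed_ball_ /= sub0r normrN.
by rewrite le_max lexx.
Qed.

(** Each basis vector gives a continuous function of [p], bounded on the ball
    by compactness. *)
Lemma linear_family_bounded n k (W : normedModType R) (f : 'rV[R]_n -> 'rV[R]_k -> W) :
  (forall p, linear (f p)) -> (forall v, continuous (f^~ v)) ->
  forall B, exists2 K, 0 < K & forall z v, `|z| <= B -> `|f z v| <= K * `|v|.
Proof.
move=> lf cf B.
have /choice[K hK] : forall j : 'I_k, exists K, 0 < K /\ forall z, `|z| <= B ->
    `|f z (basis_vec j)| <= K.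
  by move=> j; have [K K0 hK] := continuous_bounded_ball (cf (basis_vec j)) B; exists K.
exists (1 + \sum_j K j).
  by rewrite ltr_wpDr// sumr_ge0// => j _; have [/ltW] := hK j.
move=> z v zB; rewrite (linear_eq_sum v (lf z)) mulrDl mul1r -[leLHS]add0r lerD//.
apply: le_trans (ler_norm_sum _ _ _) _; rewrite mulr_suml; apply: ler_sum => j _.
rewrite normrZ mulrC ler_pM ?coord_le//.
by have [_] := hK j; apply.
Qed.

(** A first exit argument: as long as [g] is in the unit ball it is in the
    ball of radius [k < 1], so that it never leaves the unit ball. *)
Lemma bounded_from_start n (g : R -> 'rV[R]_n) (a b k : R) : a <= b -> k < 1 ->
  (forall t, a <= t <= b -> forall e, 0 < e -> exists2 d, 0 < d &
    forall s, a <= s <= b -> `|s - t| < d -> `|g s - g t| < e) ->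
  `|g a| <= 1 ->
  (forall s, a <= s <= b -> (forall t, a <= t <= s -> `|g t| <= 1) -> `|g s| <= k) ->
  forall s, a <= s <= b -> `|g s| <= k.
Proof.
move=> ab k1 cg ga1 hk.
suff H : forall s, a <= s <= b -> `|g s| <= 1.
  by move=> s /andP[as_ sb]; apply: hk; rewrite ?as_// => t /andP[at_ ts];
     apply: H; rewrite at_ (le_trans ts).
pose P t := forall s, a <= s <= t -> `|g s| <= 1.
have e0 : 0 < 1 - k by rewrite subr_gt0.
have e20 : 0 < (1 - k) / 2 by lra.
have step s t : a <= s -> s < t -> t <= b ->
    (forall x, s < x -> x <= t -> `|g x - g s| <= 1 - k) -> P s -> P t.
  move=> as_ st tb hx Ps x /andP[ax xt].
  have sab : a <= s <= b by rewrite as_ (le_trans (ltW st)).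
  have [xs|sx] := leP x s; first by apply: Ps; rewrite ax.
  rewrite -[g x](subrK (g s)); apply: le_trans (ler_normD _ _) _.
  by apply: le_trans (lerD (hx _ sx xt) (hk s sab Ps)) _; rewrite subrK.
suff : P b by [].
apply: (@real_induction R a b P) => //.
- by move=> s; rewrite -eq_le => /eqP <-.
- move=> t at_ tb Pt; have tab : a <= t <= b by rewrite at_ ltW.
  have [d d0 hd] := cg t tab _ e0; exists d => // s ts std sb.
  apply: (step t s) => // x tx xs; apply/ltW/hd.
    by rewrite (le_trans at_ (ltW tx)) (le_trans xs).
  by rewrite gtr0_norm ?subr_gt0//; lra.
- move=> t at_ tb; have tab : a <= t <= b by rewrite tb ltW.
  have [d d0 hd] := cg t tab _ e20; exists d => // s ts st as_ Ps.
  have hd' x : s <= x -> x <= t -> `|g x - g t| <= (1 - k) / 2.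
    move=> sx xt; apply/ltW/hd; first by rewrite (le_trans as_ sx) (le_trans xt).
    by rewrite distrC ger0_norm ?subr_ge0//; lra.
  apply: (step s t) => // x sx xt; rewrite -[g x](subrK (g t)) -addrA.
  apply: le_trans (ler_normD _ _) _; rewrite [leRHS](splitr (1 - k)) lerD//.
    exact: hd' (ltW sx) xt.
  by rewrite distrC hd'// ltW.
Qed.

End Bounds.

(** * Length controls displacement *)

Section Horizontal.
Context {R : realType} {r m : nat} (G : carnot_group R r m).
Local Notation n := (r + m)%N.
Local Notation V := 'rV[R]_n.
Local Notation U := 'rV[R]_r.
Local Notation mu := (@lebesgue_measure R).
Local Notation "x ** y" := (gmul G x y) (at level 40, left associativity).

Lemma hor_linear : linear (@hor R r m).
Proof. by move=> a u v; rewrite /hor scale_row_mx add_row_mx scaler0 addr0. Qed.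

Lemma hor_norm (u : U) : `|hor u : V| <= `|u|.
Proof.
apply: norm_rV_le => // j; case: (split_ordP j) => k ->.
  by rewrite row_mxEl coord_le.
by rewrite row_mxEr mxE normr0.
Qed.

Lemma enorm_ge (u : U) : `|u| <= enorm u.
Proof.
apply: norm_rV_le => [|j]; first exact: sqrtr_ge0.
rewrite -sqrtr_sqr /enorm ler_wsqrtr// (bigD1 j)//= lerDl.
by apply: sumr_ge0 => i _; rewrite sqr_ge0.
Qed.

Lemma dgmul_continuous v : continuous (fun p : V * V => dgmul G p.1 p.2 0 v).
Proof.
have [_ /(_ (0, v)) h] := gmul_smooth G 1%N.
rewrite (_ : (fun p => _) = (fun p => 'd (gmulp G) p (0, v))); first exact: h.
by apply/funext => -[p q]; rewrite dgmul.unlock.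
Qed.

Lemma lfield_continuous v : continuous (fun p => lfield G p v).
Proof.
move=> p; have -> : (fun p => lfield G p v) =
    (fun q : V * V => dgmul G q.1 q.2 0 v) \o (fun p => (p, 0)).
  by apply/funext => q /=; rewrite lfield.unlock.
apply: continuous_comp; last exact: dgmul_continuous.
apply: differentiable_continuous.
by apply: differentiable_pair => //; exact: differentiable_cst.
Qed.

Lemma dgmul_continuousr x v : continuous (fun p => dgmul G x p 0 v).
Proof.
move=> p; have -> : (fun p => dgmul G x p 0 v) =
    (fun q : V * V => dgmul G q.1 q.2 0 v) \o (fun p => (x, p)) by [].
apply: continuous_comp; last exact: dgmul_continuous.
apply: differentiable_continuous.
by apply: differentiable_pair => //; exact: differentiable_cst.
Qed.

(** The image of an absolutely continuous curve under translations and
    dilations is absolutely continuous for this reason. *)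
Lemma dil_translation_lipschitz l x B : exists2 K, 0 < K & forall p q, `|p| <= B -> `|q| <= B ->
  `|dil G l (x ** p) - dil G l (x ** q)| <= K * `|p - q|.
Proof.
have [K1 K10 hK1] := linear_bound (dil_linear G l).
have [K K0 hK] := linear_family_bounded (fun p => dgmul_linearr G x p) (@dgmul_continuousr x) B.
exists (K1 * K); first exact: mulr_gt0.
move=> p q pB qB; rewrite -(linear_eqB _ _ (dil_linear G l)) -mulrA.
apply: le_trans (hK1 _) _; rewrite ler_wpM2l ?(ltW K10)//.
have h t : deriv_in `[0, 1] (fun s : R => x ** (q + s *: (p - q))) t
    (dgmul G x (q + t *: (p - q)) 0 (p - q)).
  apply: deriv_in_gmul; first exact: deriv_in_cst.
  rewrite -[X in deriv_in _ _ _ X]add0r.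
  by apply: deriv_inD; [exact: deriv_in_cst|exact: deriv_in_scale].
have -> : x ** p - x ** q = x ** (q + 1 *: (p - q)) - x ** (q + 0 *: (p - q)) - (1 - 0) *: 0.
  by rewrite scaler0 subr0 scale1r scale0r addr0 [q + _]addrC subrK.
rewrite -[leRHS]mulr1 -{3}[1]subr0.
apply: (@mean_value R _ _ _ 0 1 0 (K * `|p - q|) ler01 (fun t _ => h t)).
move=> t /andP[t0 t1]; rewrite subr0; apply: hK.
have -> : q + t *: (p - q) = t *: p + (1 - t) *: q.
  by rewrite scalerBr scalerBl scale1r [RHS]addrC addrAC -addrA.
apply: le_trans (ler_normD _ _) _; rewrite !normrZ ger0_norm// [`|1 - t|]ger0_norm ?subr_ge0//.
rewrite (_ : B = t * B + (1 - t) * B) ?lerD//; last by ring.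
  by rewrite ler_wpM2l.
by rewrite ler_wpM2l// subr_ge0.
Qed.

(** Translating the starting point to the identity and dilating gives a
    horizontal curve with velocity [l *: u]. In the unit ball the left
    invariant fields are bounded by [C], so that the displacement is at most
    [C * l] times the length there; the assumption [C * (l * L) < 1] prevents
    the curve from leaving this ball. *)
Lemma horizontal_bound : exists2 C, 0 < C & forall a b g u x l L,
  a < b -> horizontal G a b g u -> g a = x -> 0 < l ->
  (curve_length a b u < L%:E)%E -> C * (l * L) < 1 ->
  `|dil G l (- x ** g b)| <= C * (l * L).
Proof.
have [C C0 hC] := linear_family_bounded (fun p => lfield_linear G p) lfield_continuous 1.
exists C => // a b g u x l L ab [AC uint hder] gax l0 lenL CL1.
pose h t := enorm (u t).
have mh : measurable_fun `[a, b]%classic h.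
  have mj (j : 'I_r) : measurable_fun `[a, b]%classic (fun t => u t 0 j).
    by have /integrableP[/measurable_EFinP] := uint j.
  apply: measurableT_comp; first exact: (continuous_measurable_fun (@sqrt_continuous R)).
  by apply: measurable_sum => j; apply: measurable_funX.
have h0 t : 0 <= h t by exact: sqrtr_ge0.
have [F [Fnd F0 FL Fder]] := primitive_exists h0 mh lenL.
pose phi t := dil G l (- x ** g t).
have [B hB] := ac_bounded (ltW ab) AC.
have [K K0 hK] := dil_translation_lipschitz l (- x) B.
have phiAC s : s <= b -> abs_continuous a s phi.
  move=> sb e e0; have [d d0 hd] := AC _ (divr_gt0 e0 K0); exists d => // k c d' h1 h2 h3.
  have h1' i : a <= c i /\ c i < d' i /\ d' i <= b.
    by have [? [? ?]] := h1 i; do 2 split => //; apply: le_trans sb.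
  have := hd k c d' h1' h2 h3; rewrite ltr_pdivlMr// mulrC; apply: le_lt_trans.
  rewrite mulr_sumr; apply: ler_sum => i _; have [p1 [p2 p3]] := h1' i.
  by apply: hK; apply: hB; rewrite ?p1 ?p3 ?(le_trans p1 (ltW p2)) ?(le_trans (ltW p2) p3).
have phia : phi a = 0 by rewrite /phi gax gmulVg (linear_eq0 (dil_linear G l)).
rewrite -[dil G l _]/(phi b).
apply: (@bounded_from_start R _ phi a b (C * (l * L)) (ltW ab)) => //; last by rewrite lexx ltW.
- move=> t tab e e0; have [d d0 hd] := ac_cont (phiAC b (lexx b)) e0.
  by exists d => // s sab; exact: hd.
- by rewrite phia normr0.
- move=> s /andP[as_ sb] hs.
  rewrite -[phi s]subr0 -phia.
  apply: le_trans (_ : (fun t => C * l * F t) s - (fun t => C * l * F t) a <= _); last first.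
    rewrite /= -mulrBr -mulrA ler_wpM2l ?(ltW C0)// ler_wpM2l ?(ltW l0)//.
    by rewrite lerBlDr; apply: le_trans (FL s sb) _; rewrite lerDl.
  apply: (@ac_increment R _ a s phi (fun t => C * l * F t) as_ (phiAC s sb)).
    move=> s1 t1 _ st _; rewrite ler_wpM2l ?Fnd// mulr_ge0 ?ltW//.
  move: hder Fder; apply: filterS2; first exact: (ae_filter_ringOfSetsType mu).
  move=> t hg hF tas e e0.
  have := tas; rewrite in_itv /= => /andP[at_ ts].
  have tab : t \in `]a, b[ by rewrite in_itv /= at_ (lt_le_trans ts sb).
  have {hg} := is_derive_deriv_in (hg tab); rewrite linvE => hg.
  have hphi : deriv_in setT phi t (l *: lfield G (phi t) (hor (u t))).
    have := deriv_in_linear (dil_linear G l) (deriv_in_left (- x) hg).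
    by rewrite dil_lfield dil_hor (linear_eqZ _ _ (lfield_linear _ _)).
  have hFd := hF tab.
  have e20 : 0 < e / 2 by lra.
  have Cl0 : 0 < 1 + C * l by rewrite ltr_wpDr// mulr_ge0// ltW.
  have [d1 d10 hd1] := (deriv_inP _ _ _ _).1 hphi _ e20.
  have [d2 d20 hd2] := (deriv_inP _ _ _ _).1 hFd _ (divr_gt0 e20 Cl0).
  exists (Num.min d1 d2); first by rewrite lt_min d10.
  move=> y yas; rewrite lt_min => /andP[/(hd1 y I) h1 /(hd2 y I) h2].
  have bound : `|(y - t) *: (l *: lfield G (phi t) (hor (u t)))| <= C * l * (`|y - t| * h t).
    rewrite !normrZ (gtr0_norm l0).
    have := hC (phi t) (hor (u t)) (hs t _); rewrite (ltW at_) (ltW ts) => /(_ isT) h3.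
    have h4 : `|lfield G (phi t) (hor (u t))| <= C * h t.
      apply: le_trans h3 _; rewrite ler_wpM2l ?(ltW C0)//.
      exact: le_trans (hor_norm _) (enorm_ge _).
    apply: le_trans (ler_wpM2l (normr_ge0 _) (ler_wpM2l (ltW l0) h4)) _.
    by rewrite le_eqVlt; apply/orP; left; apply/eqP; ring.
  have h5 : `|y - t| * h t <= `|F y - F t| + e / 2 / (1 + C * l) * `|y - t|.
    rewrite -[in leLHS](ger0_norm (h0 t)) -normrM.
    have -> : (y - t) * h t = (F y - F t) - (F y - F t - (y - t) * h t).
      by rewrite opprB [RHS]addrC subrK.
    by apply: le_trans (ler_normB _ _) _; rewrite lerD2l.
  rewrite -[phi y - phi t](subrK ((y - t) *: (l *: lfield G (phi t) (hor (u t))))).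
  apply: le_trans (ler_normD _ _) _; apply: le_trans (lerD h1 bound) _.
  have Cl : 0 <= C * l by rewrite mulr_ge0 ?ltW.
  apply: le_trans (lerD (lexx _) (ler_wpM2l Cl h5)) _.
  rewrite -mulrBr normrM (ger0_norm Cl) mulrDr addrCA lerD2l.
  have -> : e * `|y - t| = e / 2 * `|y - t| + e / 2 * `|y - t| by rewrite -mulrDl -splitr.
  rewrite lerD2l mulrA ler_wpM2r// mulrCA -[leRHS]mulr1 ler_wpM2l ?(ltW e20)//.
  by rewrite ler_pdivrMr// mul1r lerDr.
Qed.

(** The point of the scale [l] is that the bound does not depend on it. *)
Lemma cc_dist_bound : exists2 C, 0 < C & forall x y l e, 0 < l -> C * e < 1 ->
  (cc_dist G x y < (e * l)%:E)%E -> `|dil G l^-1 (- x ** y)| <= C * e.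
Proof.
have [C C0 hC] := horizontal_bound; exists C => // x y l e l0 Ce.
move=> /ereal_inf_lt[L [a [b [g [u [ab hg gax gby ->]]]]] hL].
have := hC a b g u x l^-1 (e * l) ab hg gax.
have E : l^-1 * (e * l) = e by rewrite mulrCA mulVf ?mulr1// gt_eqF.
by rewrite invr_gt0 gby E; apply.
Qed.

End Horizontal.

(** * Continuity within a subset of the line *)

Section Local.
Context {R : realType} {W : normedModType R}.
Implicit Types (A : set R) (f g : R -> W).

Variant cont_in A f (t : R) : Prop :=
  ContIn of (forall e : R, 0 < e -> exists2 d : R, 0 < d &
    forall s, A s -> `|s - t| < d -> `|f s - f t| < e).

Lemma cont_inP A f t : cont_in A f t <-> forall e : R, 0 < e ->
  exists2 d : R, 0 < d & forall s, A s -> `|s - t| < d -> `|f s - f t| < e.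
Proof. by split=> [[]|]. Qed.

Lemma cont_inS A B f t : A `<=` B -> cont_in B f t -> cont_in A f t.
Proof. by move=> AB [h]; split=> e /h[d d0 hd]; exists d => // s As; apply: hd; exact: AB. Qed.

Lemma deriv_in_cont A f t v : deriv_in A f t v -> cont_in A f t.
Proof. by move=> h; split=> e e0; exact: deriv_in_near h _ e0. Qed.

Lemma continuous_cont_in f : continuous f <-> forall t, cont_in setT f t.
Proof.
split=> [cf t|h t].
  split=> e e0; have /cvgrPdistC_lt/(_ e e0)/nbhs_ballP[d /= d0 hd] := cf t.
  by exists d => // s _ st; apply: hd; rewrite /ball /= distrC.
apply/cvgrPdistC_lt => e e0; have [d d0 hd] := (cont_inP _ _ _).1 (h t) e e0.
by apply/nbhs_ballP; exists d => //= s st; apply: hd => //; rewrite distrC.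
Qed.

Lemma within_cont_in A f : {within A, continuous f} -> forall t, A t -> cont_in A f t.
Proof.
move=> /subspace_continuousP h t At; split=> e e0.
have /cvgrPdistC_lt/(_ e e0) := h t At; rewrite near_withinE => /nbhs_ballP[d /= d0 hd].
by exists d => // s As st; apply: hd => //; rewrite /ball /= distrC.
Qed.

Lemma deriv_in_local A B f t v d0 : 0 < d0 -> (forall s, A s -> `|s - t| < d0 -> B s) ->
  deriv_in B f t v -> deriv_in A f t v.
Proof. by move=> d00 AB /deriv_inP h; apply/deriv_inP; exact: (near_in_local d00 AB h). Qed.

Lemma cont_in_local A B f t d0 : 0 < d0 -> (forall s, A s -> `|s - t| < d0 -> B s) ->
  cont_in B f t -> cont_in A f t.
Proof. by move=> d00 AB /cont_inP h; apply/cont_inP; exact: (near_in_local d00 AB h). Qed.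

Lemma deriv_in_glue A (b : R) f t v :
  (t <= b -> deriv_in (A `&` [set s | s <= b]) f t v) ->
  (b <= t -> deriv_in (A `&` [set s | b <= s]) f t v) -> deriv_in A f t v.
Proof.
move=> h1 h2; apply/deriv_inP.
by apply: (near_in_glue (b := b)) => [/h1/deriv_inP|/h2/deriv_inP].
Qed.

Lemma cont_in_glue A (b : R) f t :
  (t <= b -> cont_in (A `&` [set s | s <= b]) f t) ->
  (b <= t -> cont_in (A `&` [set s | b <= s]) f t) -> cont_in A f t.
Proof.
move=> h1 h2; apply/cont_inP.
by apply: (near_in_glue (b := b)) => [/h1/cont_inP|/h2/cont_inP].
Qed.

Lemma deriv_in_eq A f g t v : (forall s, A s -> f s = g s) -> f t = g t ->
  deriv_in A f t v -> deriv_in A g t v.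
Proof. by move=> fg; apply: (@deriv_in_ext R W A f g t v 1) => // s As _; exact: fg. Qed.

Lemma cont_in_eq A f g t : (forall s, A s -> f s = g s) -> f t = g t ->
  cont_in A f t -> cont_in A g t.
Proof.
by move=> fg ft [h]; split=> e /h[d d0 hd]; exists d => // s As; rewrite -fg// -ft; apply: hd.
Qed.

Lemma cont_in_affine A B f t (al be : R) :
  (forall s, A s -> B (al + be * s)) -> cont_in B f (al + be * t) ->
  cont_in A (fun s => f (al + be * s)) t.
Proof.
move=> AB [h]; split=> e /h[d d0 hd].
have k0 : 0 < 1 + `|be| by rewrite ltr_wpDr.
exists (d / (1 + `|be|)); first exact: divr_gt0.
move=> s As; rewrite ltr_pdivlMr// => st; apply: hd; first exact: AB.
have -> : al + be * s - (al + be * t) = be * (s - t) by ring.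
by apply: le_lt_trans st; rewrite normrM mulrC ler_wpM2l// lerDr.
Qed.

Lemma cont_in_cst A (c : W) t : cont_in A (fun=> c) t.
Proof. by split=> e e0; exists 1 => // s _ _; rewrite subrr normr0. Qed.

Lemma cont_in_scale A f t (k : R) : cont_in A f t -> cont_in A (fun s => k *: f s) t.
Proof.
move=> [h]; split=> e e0; have k0 : 0 < 1 + `|k| by rewrite ltr_wpDr.
have [d d0 hd] := h _ (divr_gt0 e0 k0); exists d => // s As /(hd _ As).
rewrite -scalerBr normrZ ltr_pdivlMr// mulrC; apply: le_lt_trans.
by rewrite ler_wpM2r// lerDr.
Qed.

End Local.

(** * Horizontal curves of class C^1 and pliability *)

Section Paths.
Context {R : realType} {r m : nat} (G : carnot_group R r m).
Local Notation n := (r + m)%N.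
Local Notation V := 'rV[R]_n.
Local Notation U := 'rV[R]_r.
Local Notation "x ** y" := (gmul G x y) (at level 40, left associativity).
Implicit Types (g : R -> V) (u : R -> U).

(** [C1H] without the proofs. Curves are mostly taken on the whole line, where
    one-sided derivatives do not occur. *)
Definition hpath (A : set R) g u := forall t, A t ->
  deriv_in A g t (lfield G (g t) (hor (u t))) /\ cont_in A u t.

Lemma deriv_in_ray A p v (a t : R) :
  deriv_in A (fun s => p ** ((s - a) *: v)) t (lfield G (p ** ((t - a) *: v)) v).
Proof.
apply: deriv_in_left; rewrite lfield_ray.
have := @deriv_in_affine R V A setT (fun s => s *: v) t v (- a) 1 (fun _ _ => I).
rewrite scale1r => /(_ (deriv_in_scale _ _ _)).
by apply: deriv_in_eq => [s _|]; rewrite mul1r addrC.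
Qed.

Lemma hpath_glue A b g1 u1 g2 u2 : A b ->
  hpath (A `&` [set s | s <= b]) g1 u1 -> hpath (A `&` [set s | b <= s]) g2 u2 ->
  g1 b = g2 b -> u1 b = u2 b ->
  hpath A (fun t => if t <= b then g1 t else g2 t) (fun t => if t <= b then u1 t else u2 t).
Proof.
move=> Ab h1 h2 gb ub t At.
have E1 (T : Type) (f1 f2 : R -> T) s : s <= b -> (if s <= b then f1 s else f2 s) = f1 s.
  by move=> ->.
have E2 (T : Type) (f1 f2 : R -> T) s : f1 b = f2 b -> b <= s ->
    (if s <= b then f1 s else f2 s) = f2 s.
  by move=> fb; rewrite le_eqVlt => /predU1P[<-|]; [rewrite lexx|rewrite ltNge => /negbTE ->].
split.
  apply: (deriv_in_glue (b := b)) => tb.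
    have [//|h _] := h1 t; rewrite !E1//.
    by apply: deriv_in_eq h => [s [_ /= sb]|]; rewrite E1.
  have [//|h _] := h2 t; rewrite !E2//.
  by apply: deriv_in_eq h => [s [_ /= sb]|]; rewrite E2.
apply: (cont_in_glue (b := b)) => tb.
  have [//|_ h] := h1 t.
  by apply: cont_in_eq h => [s [_ /= sb]|]; rewrite E1.
have [//|_ h] := h2 t.
by apply: cont_in_eq h => [s [_ /= sb]|]; rewrite E2.
Qed.

Lemma hpathS A B g u : A `<=` B -> hpath B g u -> hpath A g u.
Proof.
by move=> AB h t /AB/h[h1 h2]; split; [exact: deriv_inS h1|exact: cont_inS h2].
Qed.

Lemma hpath_ray A p (v : U) a : hpath A (fun s => p ** ((s - a) *: hor v)) (fun=> v).
Proof. by move=> t _; split; [exact: deriv_in_ray|exact: cont_in_cst]. Qed.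

(** By one-parameter subgroups on both sides, matching the positions and the
    velocities at the endpoints. *)
Lemma hpath_extend a b g u : a <= b -> hpath `[a, b] g u ->
  exists g' u', hpath setT g' u' /\
    forall t, a <= t <= b -> g' t = g t /\ u' t = u t.
Proof.
move=> ab h.
have h1 := @hpath_glue [set s | a <= s] b g u (fun s => g b ** ((s - b) *: hor (u b))) (fun=> u b) ab.
have {}h1 := h1 _ (@hpath_ray _ _ _ _).
rewrite subrr scale0r gmul0r in h1.
have {}h1 := h1 _ erefl erefl.
set g1 := (fun t => if t <= b then _ else _) in h1.
set u1 := (fun t => if t <= b then _ else u b) in h1.
have {}h1 : hpath [set s | a <= s] g1 u1.
  by apply: h1; apply: hpathS h => s [/= as_ sb]; rewrite /= in_itv /= as_.
have h2 := @hpath_glue setT a (fun s => g a ** ((s - a) *: hor (u a))) (fun=> u a) g1 u1 I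
  (@hpath_ray _ _ _ _).
have {}h2 : hpath (setT `&` [set s | a <= s]) g1 u1 -> _ := h2.
eexists; eexists; split.
  apply: h2; first by rewrite setTI.
    by rewrite subrr scale0r gmul0r /g1 ab.
  by rewrite /u1 ab.
move=> t /andP[at_ tb] /=.
case: ifP => [ta|_]; last by rewrite /g1 /u1 tb.
have -> : t = a by apply/eqP; rewrite eq_le ta.
by rewrite subrr scale0r gmul0r.
Qed.

(** Left translation, dilation and affine change of time at once: the
    operations on curves below are instances of it. *)
Lemma hpath_affine g u p l al be : hpath setT g u ->
  hpath setT (fun t => p ** dil G l (g (al + be * t)))
    (fun t => (l * be) *: u (al + be * t)).
Proof.
move=> h t _; have [h1 h2] := h (al + be * t) I; split.
  have h3 := @deriv_in_affine R V setT setT g t _ al be (fun _ _ => I) h1.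
  have := deriv_in_linear (dil_linear G l) h3.
  rewrite (linear_eqZ _ _ (dil_linear G l)) dil_lfield dil_hor.
  rewrite -(linear_eqZ _ _ (lfield_linear _ _)) scalerA [be * l]mulrC.
  rewrite -(linear_eqZ _ _ (@hor_linear R r m)) => h4.
  exact: deriv_in_left h4.
by apply: cont_in_scale; exact: (@cont_in_affine _ _ setT setT).
Qed.

(** The reachability relation behind pliability. A dilation of space and time
    by the same ratio does not change the velocity, so that the relation is
    compatible, for the same [e], with dilation, reversal and concatenation.
    *)
Definition connects_near (T e : R) (V0 W1 : U) (q : V) (W2 : U) := exists g u,
  [/\ hpath setT g u, g 0 = 0 /\ u 0 = W1, g T = q /\ u T = W2 &
      forall t, 0 <= t <= T -> `|u t - V0| <= e].

Lemma connects_near_scale l T e V0 W1 q W2 : 0 < l ->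
  connects_near T e V0 W1 q W2 -> connects_near (l * T) e V0 W1 (dil G l q) W2.
Proof.
move=> l0 [g [u [h [g0 u0] [gT uT] hu]]].
have := hpath_affine 0 l 0 l^-1 h; rewrite divff ?gt_eqF// => h'.
eexists; eexists; split; first exact: h'.
- by rewrite /= mulr0 addr0 g0 (linear_eq0 (dil_linear G l)) gmul0l scale1r.
- by rewrite /= gmul0l scale1r add0r mulrA mulVf ?gt_eqF// mul1r gT uT.
- move=> t /andP[t0 tT]; rewrite /= scale1r add0r; apply: hu.
  by rewrite mulr_ge0 ?invr_ge0 ?(ltW l0)//= ler_pdivrMl.
Qed.

(** Running a curve backwards changes the sign of its velocity, and the
    dilation of ratio [-1] restores it. *)
Lemma connects_near_rev T e V0 W1 q W2 :
  connects_near T e V0 W1 q W2 -> connects_near T e V0 W2 (dil G (-1) (- q)) W1.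
Proof.
move=> [g [u [h [g0 u0] [gT uT] hu]]].
have := hpath_affine (dil G (-1) (- q)) (-1) T (-1) h.
rewrite mulrNN mulr1 => h'.
eexists; eexists; split; first exact: h'.
- by rewrite /= mulr0 addr0 gT uT -dilM gmulVg (linear_eq0 (dil_linear G _)) scale1r.
- by rewrite /= mulN1r subrr g0 u0 (linear_eq0 (dil_linear G _)) gmul0r scale1r.
- move=> t /andP[t0 tT]; rewrite /= scale1r mulN1r; apply: hu.
  by rewrite subr_ge0 tT lerBlDr lerDl.
Qed.

Lemma connects_near_cat T1 T2 e V0 W1 q1 W2 q2 W3 : 0 <= T1 ->
  connects_near T1 e V0 W1 q1 W2 -> connects_near T2 e V0 W2 q2 W3 -> 0 <= T2 ->
  connects_near (T1 + T2) e V0 W1 (q1 ** q2) W3.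
Proof.
move=> T10 [g1 [u1 [h1 [g10 u10] [g1T u1T] hu1]]] [g2 [u2 [h2 [g20 u20] [g2T u2T] hu2]]] T20.
have := hpath_affine q1 1 (- T1) 1 h2.
rewrite (_ : (fun t => q1 ** _) = (fun t => q1 ** g2 (t - T1))); last first.
  by apply/funext => t; rewrite dil1 mul1r addrC.
rewrite mulr1 (_ : (fun t => 1 *: _) = (fun t => u2 (t - T1))); last first.
  by apply/funext => t; rewrite scale1r mul1r addrC.
move=> h2'.
have := @hpath_glue setT T1 g1 u1 _ _ I (hpathS (@subsetT _ _) h1) (hpathS (@subsetT _ _) h2').
rewrite subrr g20 gmul0r g1T u20 u1T => /(_ erefl erefl) h.
eexists; eexists; split; first exact: h.
- by rewrite /= T10.
- rewrite /=; case: ifP => [T2le|_]; last by rewrite addrC addKr g2T u2T.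
  have T2E : T2 = 0.
    by apply/eqP; rewrite eq_le T20 andbT -(lerD2l T1) addr0.
  move: g2T u2T; rewrite T2E addr0 g20 u20 => <- <-.
  by rewrite gmul0r.
- move=> t /andP[t0 tT] /=; case: ifP => [tT1|/negbT]; first by apply: hu1; rewrite t0.
  rewrite -ltNge => T1t; apply: hu2; rewrite subr_ge0 (ltW T1t) /= lerBlDl//.
Qed.

Lemma connects_near_weak T e e' V0 W1 q W2 : e <= e' ->
  connects_near T e V0 W1 q W2 -> connects_near T e' V0 W1 q W2.
Proof.
move=> ee [g [u [h h1 h2 hu]]]; exists g, u; split => // t /hu => h3.
exact: le_trans h3 ee.
Qed.

(** The counterpart of [horizontal_bound] for a bounded velocity. *)
Lemma hpath_stay : exists2 C, 0 < C & forall g u M T, hpath setT g u -> g 0 = 0 ->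
  0 <= T -> (forall t, 0 <= t <= T -> `|u t| <= M) -> C * M * T < 1 -> `|g T| <= C * M * T.
Proof.
have [C C0 hC] := linear_family_bounded (fun p => lfield_linear G p) (@lfield_continuous R r m G) 1.
exists C => // g u M T h g0 T0 hu CMT.
have M0 : 0 <= M by apply: le_trans (hu 0 _); rewrite ?lexx.
apply: (@bounded_from_start R _ g 0 T (C * M * T) T0) => //; last by rewrite T0 lexx.
- move=> t _ e e0; have [/deriv_in_near/(_ e e0)[d d0 hd] _] := h t I.
  by exists d => // s _; exact: hd.
- by rewrite g0 normr0.
- move=> s /andP[s0 sT] hs.
  have := @mean_value R V g (fun t => lfield G (g t) (hor (u t))) 0 s 0 (C * M) s0.
  rewrite g0 !subr0 scaler0 subr0 => h1; apply: le_trans (h1 _ _) _.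
  + by move=> t _; have [h2 _] := h t I; exact: deriv_inS h2.
  + move=> t /andP[t0 ts]; rewrite subr0; apply: le_trans (hC _ _ (hs t _)) _.
      by rewrite t0.
    rewrite ler_wpM2l ?(ltW C0)//; apply: le_trans (hor_norm _) (hu _ _).
    by rewrite t0 (le_trans ts).
  + by rewrite ler_wpM2l// mulr_ge0// ltW.
Qed.



(** Speeds vanishing at one end of an interval serve to start and to stop. *)
Lemma hpath_line (V0 : U) (al be : R) :
  hpath setT (fun t => (al * t + be * t ^+ 2) *: hor V0) (fun t => (al + be * (t *+ 2)) *: V0).
Proof.
move=> t _; split; last first.
  have -> : (fun t => (al + be * (t *+ 2)) *: V0) =
      (fun t => (fun s : R => s *: V0) (al + (be * 2) * t)).
    by apply/funext => s; rewrite -mulr_natl mulrA.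
  exact: (@cont_in_affine R _ setT setT (fun s => s *: V0) t al (be * 2) (fun _ _ => I)
    (deriv_in_cont (deriv_in_scale _ _ _))).
rewrite (linear_eqZ _ _ (@hor_linear R r m)) (linear_eqZ _ _ (lfield_linear _ _)) lfield_ray.
split=> e e0; have k0 : 0 < 1 + `|be| * `|hor V0 : V| by rewrite ltr_wpDr// mulr_ge0.
exists (e / (1 + `|be| * `|hor V0 : V|)); first exact: divr_gt0.
move=> s _ st; rewrite scalerA -!scalerBl.
have -> : al * s + be * s ^+ 2 - (al * t + be * t ^+ 2) - (s - t) * (al + be * (t *+ 2)) =
  be * (s - t) * (s - t) by rewrite -mulr_natl; ring.
rewrite normrZ 2!normrM mulrAC ler_wpM2r// mulrAC.
move: st; rewrite ltr_pdivlMr// mulrC => /ltW; apply: le_trans.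
by rewrite ler_wpM2r// lerDr.
Qed.

Definition connects T (W1 : U) q (W2 : U) := exists g u,
  [/\ hpath setT g u, g 0 = 0 /\ u 0 = W1 & g T = q /\ u T = W2].

Lemma connects_nearW T e V0 W1 q W2 : connects_near T e V0 W1 q W2 -> connects T W1 q W2.
Proof. by move=> [g [u [h1 h2 h3 _]]]; exists g, u. Qed.

Lemma connects_bounded T W1 q W2 V0 : 0 <= T -> connects T W1 q W2 ->
  exists e, connects_near T e V0 W1 q W2.
Proof.
move=> T0 [g [u [h h1 h2]]].
have cu : {within `[0, T], continuous u}.
  by apply: continuous_subspaceT; apply/continuous_cont_in => t; have [] := h t I.
have /compact_bounded[M [Mr hM]] := continuous_compact cu (@segment_compact _ 0 T).
exists (M + 1 + `|V0|), g, u; split => // t tT.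
apply: le_trans (ler_normB _ _) _; rewrite lerD2r.
by apply: (hM (M + 1)); [rewrite ltrDl|exists t].
Qed.

Lemma connects_cat T1 T2 W1 q1 W2 q2 W3 : 0 <= T1 -> 0 <= T2 ->
  connects T1 W1 q1 W2 -> connects T2 W2 q2 W3 -> connects (T1 + T2) W1 (q1 ** q2) W3.
Proof.
move=> T10 T20 /(connects_bounded 0 T10)[e1 h1] /(connects_bounded 0 T20)[e2 h2].
apply: (@connects_nearW _ (Num.max e1 e2) 0); apply: (connects_near_cat T10 _ _ T20).
  by apply: connects_near_weak h1; rewrite le_max lexx.
by apply: connects_near_weak h2; rewrite le_max lexx orbT.
Qed.

Lemma connects_scale l T W1 q W2 : 0 < l -> 0 <= T -> connects T W1 q W2 ->
  connects (l * T) W1 (dil G l q) W2.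
Proof.
by move=> l0 T0 /(connects_bounded 0 T0)[e /(connects_near_scale l0)/connects_nearW].
Qed.

(** Rescaling time multiplies the velocities, which is harmless when they
    vanish at both ends. *)
Lemma connects0_time T T' q : 0 < T -> 0 < T' -> connects T 0 q 0 -> connects T' 0 q 0.
Proof.
move=> T0 T'0 [g [u [h [g0 u0] [gT uT]]]].
have := hpath_affine 0 1 0 (T / T') h => h'.
eexists; eexists; split; first exact: h'.
- by rewrite /= mulr0 addr0 g0 (linear_eq0 (dil_linear G 1)) gmul0l u0 scaler0.
- by rewrite /= gmul0l add0r mulfVK ?gt_eqF// gT uT dil1 scaler0.
Qed.

Lemma connects0_inv T q : connects T 0 q 0 -> connects T 0 (- q) 0.
Proof.
move=> [g [u [h [g0 u0] [gT uT]]]].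
have := hpath_affine (- q) 1 T (-1) h => h'.
eexists; eexists; split; first exact: h'.
- by rewrite /= mulr0 addr0 gT dil1 gmulVg uT scaler0.
- by rewrite /= mulN1r subrr g0 dil1 gmul0r u0 scaler0.
Qed.

Lemma connects_stop W : connects 1 W (2^-1 *: hor W) 0.
Proof.
have := hpath_line W 1 (- 2^-1) => h.
eexists; eexists; split; first exact: h; rewrite /=; split.
- by rewrite mulr0 expr0n mulr0 addr0 scale0r.
- by rewrite mul0rn mulr0 addr0 scale1r.
- by rewrite mulr1 expr1n mulr1; congr (_ *: _); field.
- by rewrite -mulr_natl mulr1 mulNr mulVf ?subrr ?scale0r.
Qed.

Lemma connects_start W : connects 1 0 (2^-1 *: hor W) W.
Proof.
have := hpath_line W 0 2^-1 => h.
eexists; eexists; split; first exact: h; rewrite /=; split.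
- by rewrite mulr0 expr0n mulr0 addr0 scale0r.
- by rewrite mul0rn mulr0 addr0 scale0r.
- by rewrite mulr1 expr1n mulr1 add0r.
- by rewrite -mulr_natl mulr1 mulVf ?add0r ?scale1r.
Qed.

Lemma gmul_near (x y : V) e : 0 < e -> exists2 d, 0 < d & forall x' y',
  `|x' - x| < d -> `|y' - y| < d -> `|x' ** y' - x ** y| < e.
Proof.
move=> e0; have /differentiable_continuous/cvgrPdistC_lt/(_ e e0) := gmulp_diff G (x, y).
move=> /nbhs_ballP[d /= d0 hd]; exists d => // x' y' hx hy.
by apply: (hd (x', y')); split; rewrite -ball_normE /= distrC.
Qed.

Lemma dil_near l (x : V) e : 0 < e -> exists2 d, 0 < d & forall x',
  `|x' - x| < d -> `|dil G l x' - dil G l x| < e.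
Proof.
move=> e0; have [C C0 hC] := linear_bound (dil_linear G l).
exists (e / C); first exact: divr_gt0.
move=> x'; rewrite ltr_pdivlMr// mulrC -(linear_eqB _ _ (dil_linear G l)).
exact: le_lt_trans (hC _).
Qed.

(** Of the distance between curves only the part concerning velocities is
    used. *)
Lemma pliable_connects_near V0 : pliable_vector G V0 -> forall e, 0 < e ->
  exists2 d, 0 < d & forall q W, `|q - hor V0| < d -> `|W - V0| < d ->
    connects_near 1 e V0 V0 q W.
Proof.
move=> pV e e0; pose g0 := exp_curve G `[0, 1] V0.
have := pV [set h | (C1H_dist g0 h < e%:E)%E]; rewrite /C1H_nbhs.
move=> /(_ _)/nbhs_ballP[]; first by exists e.
move=> d /= d0 hd; exists d => // q W hq hW.
have [] := hd (q, W).
  by split => /=; rewrite -ball_normE /= distrC// /expg scale1r.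
move=> h [/= hdist [h0 v0]] [h1 v1].
have hp : hpath `[0, 1] h (velocity h).
  move=> t tI; split.
    by rewrite -linvE; apply/deriv_in_within; exact: curve_derive.
  exact: (within_cont_in (@velocity_continuous _ _ _ _ _ h)).
have [g [u [hg gu]]] := hpath_extend ler01 hp.
have I0 : 0 <= (0 : R) <= 1 by rewrite lexx ler01.
have I1 : 0 <= (1 : R) <= 1 by rewrite lexx ler01.
have [g00 u00] := gu 0 I0.
have [g11 u11] := gu 1 I1.
exists g, u; split => //.
- by rewrite g00 u00 h0 v0 /= /expg scale0r.
- by rewrite g11 u11 h1 v1.
- move=> t t01; have [_ ->] := gu t t01; apply: le_trans (enorm_ge _) _.
  rewrite -lee_fin; apply: le_trans (ltW hdist); rewrite /C1H_dist le_max.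
  by apply/orP; right; apply: ereal_sup_ubound; exists t.
Qed.

(** Pliability gives a curve from velocity [V0] to velocity [W1] ending at
    [hor V0]. Reversed, it goes from velocity [W1] to velocity [V0] and ends
    again at [hor V0]. Followed by a curve from [V0] to [W2], both at half
    scale, it reaches every [q] close to [hor V0]. *)
Lemma pliable_connects_near_open V0 : pliable_vector G V0 -> forall e, 0 < e ->
  exists2 d, 0 < d & forall W1 q W2, `|W1 - V0| < d -> `|q - hor V0| < d ->
    `|W2 - V0| < d -> connects_near 1 e V0 W1 q W2.
Proof.
move=> pV e e0; have [d d0 hd] := pliable_connects_near pV e0.
have h0 : - (2^-1 *: hor V0) ** hor V0 = 2^-1 *: hor V0 :> V.
  by rewrite -scaleNr -{2}[hor V0]scale1r gmul_exp; congr (_ *: _); field.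
have [d1 d10 hd1] := dil_near 2 (- (2^-1 *: hor V0) ** hor V0) d0.
have [d2 d20 hd2] := gmul_near (- (2^-1 *: hor V0)) (hor V0) d10.
exists (Num.min d d2); first by rewrite lt_min d0.
move=> W1 q W2; rewrite !lt_min => /andP[hW1 _] /andP[_ hq] /andP[hW2 _].
have c1 : connects_near 1 e V0 V0 (hor V0) W1 by apply: hd => //; rewrite subrr normr0.
have {}c1 := connects_near_rev c1.
have {c1} := connects_near_scale (_ : 0 < 2^-1) c1; rewrite invr_gt0 ltr0n => /(_ isT).
rewrite (linear_eqN _ (dil_linear _ _)) dil_hor scaleN1r opprK dil_hor => c1.
pose q' := dil G 2 (- (2^-1 *: hor V0) ** q).
have c2 : connects_near 1 e V0 V0 q' W2.
  apply: hd => //; have -> : hor V0 = dil G 2 (- (2^-1 *: hor V0) ** hor V0) :> V.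
    by rewrite h0 (linear_eqZ _ _ (dil_linear _ _)) dil_hor scalerA mulVf ?scale1r.
  by apply: hd1; apply: hd2 => //; rewrite subrr normr0.
have {c2} := connects_near_scale (_ : 0 < 2^-1) c2; rewrite invr_gt0 ltr0n => /(_ isT) c2.
have := connects_near_cat _ c1 c2; rewrite mulr1 invr_ge0 ler0n => /(_ isT isT).
by rewrite /q' dilK ?pnatr_eq0// gmulKVg (_ : 2^-1 + 2^-1 = 1)//; field.
Qed.

(** The points reachable with zero velocity at both ends form a subgroup [S].
    By pliability [S] contains a translate of a neighborhood of [hor V0],
    hence a neighborhood of 0, hence every point, as [x] is a power of
    [k^-1 *: x]. Other end velocities are reached by starting and stopping along
    lines. *)
Lemma pliable_connects V0 : pliable_vector G V0 -> forall T W1 q W2, 0 < T -> connects T W1 q W2.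
Proof.
move=> pV.
pose S x := connects 1 0 x 0.
have SM x y : S x -> S y -> S (x ** y).
  move=> Sx Sy; have := connects_cat ler01 ler01 Sx Sy.
  by apply: connects0_time => //; lra.
have [d d0 hd] := pliable_connects_near pV ltr01.
pose p := 2^-1 *: hor V0 : V.
have Sp q : `|q - hor V0| < d -> S (p ** q ** p).
  move=> hq; have h := hd q V0 hq; rewrite subrr normr0 in h.
  have := connects_cat ler01 ler01 (connects_start V0) (connects_nearW (h d0)).
  move=> /(fun h => connects_cat _ ler01 h (connects_stop V0)).
  move=> /(_ _)/connects0_time; apply => //; lra.
have p2 : p ** hor V0 ** p = 2 *: hor V0.
  by rewrite /p -[in LHS](scale1r (hor V0)) scalerA mulr1 !gmul_exp; congr (_ *: _); field.
have S2 : S (- (2 *: hor V0)).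
  by apply: connects0_inv; rewrite -/(S _) -p2; apply: Sp; rewrite subrr normr0.
have [d1 d10 hd1] := gmul_near (- p ** (2 *: hor V0)) (- p) d0.
have [d2 d20 hd2] := gmul_near (- p) (2 *: hor V0) d10.
have [d3 d30 hd3] := gmul_near (2 *: hor V0) 0 d20.
have Ssmall x : `|x| < d3 -> S x.
  move=> x3; have -> : x = - (2 *: hor V0) ** (p ** (- p ** (2 *: hor V0 ** x) ** - p) ** p).
    by rewrite -!gmulA gmulVg gmul0r gmulKVg gmulKg.
  apply: SM => //; apply: Sp.
  have E : hor V0 = - p ** (2 *: hor V0) ** - p :> V by rewrite -p2 -!gmulA gmulgV gmul0r gmulKg.
  rewrite [X in `|_ - X|]E.
  have z0 : `|- p - - p| = 0 by rewrite subrr normr0.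
  apply: hd1; rewrite ?z0//; apply: hd2; rewrite ?z0//.
  by have := hd3 (2 *: hor V0) x; rewrite subrr normr0 gmul0r subr0; apply.
have Sall x : S x.
  have [k hk] : exists k : nat, `|x| < d3 * k.+1%:R.
    have xd : 0 <= `|x| / d3 by rewrite divr_ge0// ltW.
    exists (Num.bound (`|x| / d3)); rewrite mulrC -ltr_pdivrMr//.
    by apply: lt_le_trans (archi_boundP xd) _; rewrite ler_nat.
  pose y := k.+1%:R^-1 *: x.
  have Sy : S y.
    by apply: Ssmall; rewrite normrZ normfV normr_nat mulrC ltr_pdivrMr ?ltr0n.
  have -> : x = k.+1%:R *: y by rewrite scalerA divff ?scale1r// pnatr_eq0.
  elim: (k) => [|j IH]; first by rewrite scale1r.
  by rewrite -natr1 -(gmul_exp G) scale1r; exact: SM.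
move=> T W1 q W2 T0.
have T3 : 0 < T / 3 by rewrite divr_gt0.
have j1 := connects_scale T3 ler01 (connects_stop W1).
have j3 := connects_scale T3 ler01 (connects_start W2).
move: j1 j3; set q1 := dil _ _ _; set q3 := dil _ _ _; rewrite mulr1 => j1 j3.
have j2 : connects (T / 3) 0 (- q1 ** q ** - q3) 0 by exact: connects0_time (Sall _).
have := connects_cat _ _ (connects_cat _ _ j1 j2) j3.
rewrite (ltW T3) => /(_ _ isT isT isT).
rewrite -[- q1 ** q ** - q3]gmulA gmulKVg gmulgKV addr_ge0 ?(ltW T3)// => /(_ isT).
by congr connects; field.
Qed.

End Paths.

(** * Gaps of a compact subset of the line *)

Section CompactSubsets.
Context {R : realType}.
Implicit Types (K : set R).

Lemma compact_has_max K x : compact K -> K x ->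
  exists2 c, K c & forall k, K k -> k <= c.
Proof.
move=> cK Kx; have [|//|c cK' hc] := @compact_EVT_max R R id K _ cK.
- by exists x.
- by apply: continuous_subspaceT => y; exact: cvg_id.
by exists c; [rewrite -inE|move=> k Kk; apply: hc; rewrite inE].
Qed.

Lemma compact_has_min K x : compact K -> K x ->
  exists2 c, K c & forall k, K k -> c <= k.
Proof.
move=> cK Kx; have [|//|c cK' hc] := @compact_EVT_min R R id K _ cK.
- by exists x.
- by apply: continuous_subspaceT => y; exact: cvg_id.
by exists c; [rewrite -inE|move=> k Kk; apply: hc; rewrite inE].
Qed.

Lemma compact_left K a t : compact K -> K a -> a <= t ->
  exists c, [/\ K c, c <= t & forall k, K k -> k <= t -> k <= c].
Proof.
move=> cK Ka at_; have cK' : compact (K `&` [set` `]-oo, t]]).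
  by apply: compact_closedI => //; exact: interval_closed.
have [|c [Kc ct] hc] := compact_has_max cK' (x := a).
  by split => //; rewrite /= in_itv.
exists c; split => //.
by move=> k Kk kt; apply: hc; split => //; rewrite /= in_itv.
Qed.

Lemma compact_right K b t : compact K -> K b -> t <= b ->
  exists c, [/\ K c, t <= c & forall k, K k -> t <= k -> c <= k].
Proof.
move=> cK Kb tb; have cK' : compact (K `&` [set` `[t, +oo[]).
  by apply: compact_closedI => //; exact: interval_closed.
have [|c [Kc ct] hc] := compact_has_min cK' (x := b).
  by split => //; rewrite /= in_itv /= andbT.
exists c; split => //; first by move: ct; rewrite /= in_itv /= andbT.
by move=> k Kk kt; apply: hc; split => //; rewrite /= in_itv /= andbT.
Qed.

End CompactSubsets.

Section Gaps.
Context {R : realType}.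
Implicit Types (K : set R).

Lemma dist_lt_double (x y t d : R) : `|x - t| < d -> `|y - t| < d -> y - x < 2 * d.
Proof.
move=> h1 h2; have := ler_norm (y - t).
by have := ler_norm (- (x - t)); rewrite normrN; lra.
Qed.

Definition gap K (c1 c2 : R) :=
  [/\ K c1, K c2, c1 < c2 & forall k, K k -> c1 < k -> k < c2 -> False].

Lemma gap_around K a b s : compact K -> K a -> K b -> a <= s <= b -> ~ K s ->
  exists c1 c2, gap K c1 c2 /\ c1 < s < c2.
Proof.
move=> cK Ka Kb /andP[as_ sb] nKs.
have [c1 [K1 l1 m1]] := compact_left cK Ka as_.
have [c2 [K2 l2 m2]] := compact_right cK Kb sb.
have c1s : c1 < s by rewrite lt_neqAle l1 andbT; apply/eqP => E; apply: nKs; rewrite -E.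
have sc2 : s < c2 by rewrite lt_neqAle l2 andbT; apply/eqP => E; apply: nKs; rewrite E.
exists c1, c2; split; last by rewrite c1s.
split => //; first exact: lt_trans sc2.
move=> k Kk; case: (leP k s) => [ks h _|sk _ h]; first by move: (m1 k Kk ks); rewrite leNgt h.
by move: (m2 k Kk (ltW sk)); rewrite leNgt h.
Qed.

Lemma gap_le K c1 c2 s k : gap K c1 c2 -> c1 < s < c2 -> K k -> k <= s -> k <= c1.
Proof.
move=> [_ _ _ h] /andP[c1s sc2] Kk ks; rewrite leNgt; apply/negP => ck.
exact: h Kk ck (le_lt_trans ks sc2).
Qed.

Lemma gap_ge K c1 c2 s k : gap K c1 c2 -> c1 < s < c2 -> K k -> s <= k -> c2 <= k.
Proof.
move=> [_ _ _ h] /andP[c1s sc2] Kk sk; rewrite leNgt; apply/negP => ck.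
exact: h Kk (lt_le_trans c1s sk) ck.
Qed.

Lemma gap_unique K c1 c2 d1 d2 s : gap K c1 c2 -> gap K d1 d2 ->
  c1 < s < c2 -> d1 < s < d2 -> c1 = d1 /\ c2 = d2.
Proof.
move=> gc gd cs ds; have [kc1 kc2 _ _] := gc; have [kd1 kd2 _ _] := gd.
have /andP[c1s sc2] := cs; have /andP[d1s sd2] := ds.
split; apply/eqP; rewrite eq_le.
  by rewrite (gap_le gd ds kc1 (ltW c1s)) (gap_le gc cs kd1 (ltW d1s)).
by rewrite (gap_ge gc cs kd2 (ltW sd2)) (gap_ge gd ds kc2 (ltW sc2)).
Qed.

Lemma gap_right K b t : compact K -> K b -> K t -> t < b ->
  (exists c, gap K t c) \/ forall e, 0 < e -> exists k, [/\ K k, t < k & k < t + e].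
Proof.
move=> cK Kb Kt tb.
have [[c hc]|nc] := pselect (exists c, gap K t c); [by left; exists c|right => e e0].
apply: contrapT => hn; apply: nc; pose h := Num.min e (b - t) / 2.
have m0 : 0 < Num.min e (b - t) by rewrite lt_min e0 subr_gt0.
have me : Num.min e (b - t) <= e by rewrite ge_min lexx.
have mb : Num.min e (b - t) <= b - t by rewrite ge_min lexx orbT.
have h1 : t + h <= b by rewrite /h; lra.
have h2 : t < t + h by rewrite /h; lra.
have h3 : t + h < t + e by rewrite /h; lra.
have [c [Kc hc cmin]] := compact_right cK Kb h1.
exists c; split => //; first exact: lt_le_trans hc.
move=> k Kk tk kc; apply: hn; exists k; split => //; apply: le_lt_trans h3.
by rewrite leNgt; apply/negP => /ltW/(cmin k Kk); rewrite leNgt kc.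
Qed.

Lemma gap_left K a t : compact K -> K a -> K t -> a < t ->
  (exists c, gap K c t) \/ forall e, 0 < e -> exists k, [/\ K k, t - e < k & k < t].
Proof.
move=> cK Ka Kt ta.
have [[c hc]|nc] := pselect (exists c, gap K c t); [by left; exists c|right => e e0].
apply: contrapT => hn; apply: nc; pose h := Num.min e (t - a) / 2.
have m0 : 0 < Num.min e (t - a) by rewrite lt_min e0 subr_gt0.
have me : Num.min e (t - a) <= e by rewrite ge_min lexx.
have mb : Num.min e (t - a) <= t - a by rewrite ge_min lexx orbT.
have h1 : a <= t - h by rewrite /h; lra.
have h2 : t - h < t by rewrite /h; lra.
have h3 : t - e < t - h by rewrite /h; lra.
have [c [Kc hc cmin]] := compact_left cK Ka h1.
exists c; split => //; first exact: le_lt_trans h2.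
move=> k Kk ck kt; apply: hn; exists k; split => //; apply: lt_le_trans h3 _.
by rewrite leNgt; apply/negP => /ltW/(cmin k Kk); rewrite leNgt ck.
Qed.

End Gaps.

(** * Filling the gaps *)

Section Whitney.
Context {R : realType} {r m : nat} (G : carnot_group R r m).
Local Notation n := (r + m)%N.
Local Notation V := 'rV[R]_n.
Local Notation U := 'rV[R]_r.
Local Notation "x ** y" := (gmul G x y) (at level 40, left associativity).
Context (K : set R) (gamma : R -> V) (X : R -> U).
Context (cK : compact K) (cX : {within K, continuous X}).
Context (rate0 : whitney_rate G K gamma X eta @[eta --> 0^'+] --> 0%E).
Context (pX : forall t, K t -> pliable_vector G (X t)).

Lemma rate_cc_dist e : 0 < e -> exists2 d, 0 < d & forall tau t, K tau -> K t ->
  0 < `|t - tau| < d ->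
  (cc_dist G (gamma t) (gamma tau ** ((t - tau) *: hor (X tau))) < (e * `|t - tau|)%:E)%E.
Proof.
move=> e0.
have : \forall eta \near 0^'+, (whitney_rate G K gamma X eta < e%:E)%E.
  have := rate0; move/(_ [set y | (y < e%:E)%E]); apply.
  by apply: open_nbhs_nbhs; split; [exact: open_ereal_lt_ereal|rewrite /= lte_fin].
rewrite near_withinE => /nbhs_ballP[d /= d0 hd].
have d20 : 0 < d / 2 by lra.
exists (d / 2) => // tau t Ktau Kt /andP[tt0 ttd].
have := hd (d / 2); rewrite /ball /= sub0r normrN gtr0_norm// => h.
have {h} : (whitney_rate G K gamma X (d / 2) < e%:E)%E by apply: h => //; lra.
rewrite /whitney_rate gt_max => /andP[_ hs].
set D := cc_dist _ _ _.
have : (D * (`|tau - t|^-1)%:E < e%:E)%E.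
  apply: le_lt_trans hs; apply: ereal_sup_ubound; exists tau, t; split => //.
  by rewrite distrC tt0.
rewrite distrC; case: D => [x| |].
- by rewrite -EFinM !lte_fin ltr_pdivrMr.
- by rewrite gt0_mulye// lte_fin invr_gt0.
- by rewrite ltNyr.
Qed.

(** The Whitney condition read at the scale [`|t - tau|]. *)
Lemma gamma_expansion e : 0 < e -> exists2 d, 0 < d & forall tau t, K tau -> K t ->
  0 < `|t - tau| < d -> exists z,
    gamma t = gamma tau ** ((t - tau) *: hor (X tau) ** z) /\
    `|dil G `|t - tau|^-1 z| <= e.
Proof.
move=> e0; have [C C0 hC] := cc_dist_bound G.
pose e' := Num.min (e / C) (1 / (2 * C)).
have e'0 : 0 < e' by rewrite lt_min !divr_gt0// mulr_gt0.
have Ce' : C * e' <= e by rewrite mulrC -ler_pdivlMr// ge_min lexx.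
have Ce1 : C * e' < 1.
  rewrite mulrC -ltr_pdivlMr// gt_min; apply/orP; right.
  by rewrite !div1r ltf_pV2 ?posrE ?mulr_gt0// mulr_natl mulr2n ltrDl.
have [d d0 hd] := rate_cc_dist e'0; exists d => // tau t Ktau Kt tt.
have /andP[tt0 _] := tt.
have h := hC _ _ _ _ tt0 Ce1 (hd _ _ Ktau Kt tt).
exists (- ((t - tau) *: hor (X tau)) ** (- gamma tau ** gamma t)); split.
  by rewrite gmulKVg gmulKVg.
apply: le_trans Ce'; apply: le_trans h.
rewrite -normrN -(linear_eqN _ (dil_linear _ _)).
by rewrite !gmul_inv !opprK -gmulA.
Qed.

(** The error term of [gamma_expansion] is negligible, since a dilation of
    ratio at most 1 contracts at least by its ratio. *)
Lemma deriv_in_gamma t0 : K t0 -> deriv_in K gamma t0 (lfield G (gamma t0) (hor (X t0))).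
Proof.
move=> Kt0; pose Y t : V := (t - t0) *: hor (X t0).
pose Z t := - Y t ** (- gamma t0 ** gamma t).
have Y0 : Y t0 = 0 by rewrite /Y subrr scale0r.
have Z0 : Z t0 = 0 by rewrite /Z Y0 oppr0 gmul0l gmulVg.
have hY : deriv_in K Y t0 (hor (X t0)).
  split=> e e0; exists 1 => // s _ _.
  by rewrite Y0 subr0 /Y subrr normr0 mulr_ge0// ltW.
have hZ : deriv_in K Z t0 0.
  split=> e e0; have [d d0 hd] := gamma_expansion e0.
  exists (Num.min 1 d); first by rewrite lt_min ltr01.
  move=> s Ks; rewrite lt_min => /andP[s1 sd]; rewrite scaler0 subr0 Z0 subr0.
  have [->|st] := eqVneq s t0; first by rewrite Z0 subrr !normr0 mulr0.
  have st0 : 0 < `|s - t0| by rewrite normr_gt0 subr_eq0.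
  have [|z [hz hn]] := hd t0 s Kt0 Ks; first by rewrite st0.
  have -> : Z s = z by rewrite /Z hz gmulKg gmulKg.
  rewrite -[z](@dilK R r m G `|s - t0|^-1 z) ?invr_eq0 ?gt_eqF// invrK.
  have hl : 0 <= `|s - t0| <= 1 by rewrite normr_ge0 ltW.
  apply: le_trans (dil_norm _ _ hl) _.
  by rewrite mulrC ler_wpM2r.
have := deriv_in_gmul G (deriv_in_cst K (gamma t0) t0) (deriv_in_gmul G hY hZ).
rewrite Y0 Z0 dgmul_0r gmul0r -[dgmul G (gamma t0) 0 0 _]/(_ (hor (X t0))) => h.
rewrite lfield.unlock; apply: deriv_in_eq h => [s _|]; first by rewrite /Z !gmulKVg.
by rewrite Y0 Z0 !gmul0r.
Qed.

Lemma connects_near_center T e e' V0 V1 W1 q W2 : `|V0 - V1| <= e' ->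
  connects_near G T e V0 W1 q W2 -> connects_near G T (e + e') V1 W1 q W2.
Proof.
move=> h [g [u [h1 h2 h3 hu]]]; exists g, u; split => // t /hu hut.
rewrite -[u t](subrK V0) -addrA; apply: le_trans (ler_normD _ _) _; exact: lerD.
Qed.

(** At scale [c2 - c1] the point to reach is a small perturbation of
    [hor (X c1)], hence is close to [hor (X t0)]. Thus the pliability of the single
    vector [X t0] deals with all short gaps near [t0]. *)
Lemma short_gap t0 e : K t0 -> 0 < e -> exists2 d, 0 < d & forall c1 c2, K c1 -> K c2 ->
  c1 < c2 -> `|c1 - t0| < d -> `|c2 - t0| < d ->
  connects_near G (c2 - c1) e (X c1) (X c1) (- gamma c1 ** gamma c2) (X c2).
Proof.
move=> Kt0 e0; have e20 : 0 < e / 2 by lra.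
have [d1 d10 hd1] := pliable_connects_near_open (pX Kt0) e20.
have [d2 d20 hd2] := gmul_near G (hor (X t0)) 0 d10.
have [d3 d30 hd3] : exists2 d, 0 < d & forall s, K s -> `|s - t0| < d ->
    `|X s - X t0| < Num.min (e / 2) (Num.min d1 d2).
  have /cont_inP := within_cont_in cX Kt0; apply.
  by rewrite !lt_min e20 d10.
have d220 : 0 < d2 / 2 by lra.
have [d4 d40 hd4] := gamma_expansion d220.
exists (Num.min d3 (d4 / 2)); first by rewrite lt_min d30 divr_gt0.
move=> c1 c2 K1 K2 c12; rewrite !lt_min => /andP[c13 c14] /andP[c23 c24].
have l0 : 0 < c2 - c1 by rewrite subr_gt0.
have nl : `|c2 - c1| = c2 - c1 by rewrite gtr0_norm.
have := hd3 _ K1 c13; rewrite !lt_min => /and3P[x1e x1d1 x1d2].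
have := hd3 _ K2 c23; rewrite !lt_min => /and3P[x2e x2d1 x2d2].
have [|z [hz hn]] := hd4 c1 c2 K1 K2.
  rewrite nl l0 /=; have := ler_norm (c2 - t0); have := ler_norm (- (c1 - t0)).
  by rewrite normrN; lra.
rewrite nl in hn.
pose q := dil G (c2 - c1)^-1 (- gamma c1 ** gamma c2).
have qE : q = hor (X c1) ** dil G (c2 - c1)^-1 z.
  by rewrite /q hz gmulKg dilM (linear_eqZ _ _ (dil_linear _ _)) dil_hor scalerA
    divff ?gt_eqF// scale1r.
have hq : `|q - hor (X t0)| < d1.
  rewrite qE -[X in `|_ - X|](gmul0r G); apply: hd2.
    by rewrite -(linear_eqB _ _ (@hor_linear R r m)); apply: le_lt_trans (hor_norm _) _.
  by rewrite subr0; apply: le_lt_trans hn _; lra.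
have := connects_near_scale l0 (hd1 _ _ _ x1d1 hq x2d1).
rewrite mulr1 /q dil_dil divff ?gt_eqF// dil1 => h.
rewrite (splitr e); apply: connects_near_center h.
by rewrite distrC ltW.
Qed.

(** A curve in the gap whose velocity oscillates almost as little as possible,
    so that one choice suits all the points close to the gap. The least
    possible [e] need not be attained, whence the additional term [c2 - c1],
    which is small for short gaps. *)
Definition fills (c1 c2 : R) (g : R -> V) (u : R -> U) :=
  [/\ hpath G setT g u, g c1 = gamma c1 /\ u c1 = X c1, g c2 = gamma c2 /\ u c2 = X c2 &
      forall e, connects_near G (c2 - c1) e (X c1) (X c1) (- gamma c1 ** gamma c2) (X c2) ->
        forall t, c1 <= t <= c2 -> `|u t - X c1| <= e + (c2 - c1)].

Lemma fills_exists c1 c2 : K c1 -> c1 < c2 ->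
  exists gu : (R -> V) * (R -> U), fills c1 c2 gu.1 gu.2.
Proof.
move=> K1 c12; have l0 : 0 < c2 - c1 by rewrite subr_gt0.
pose S := [set e | connects_near G (c2 - c1) e (X c1) (X c1) (- gamma c1 ** gamma c2) (X c2)].
have hS : has_inf S.
  split.
    have [e he] := connects_bounded (X c1) (ltW l0)
      (pliable_connects (pX K1) (X c1) (- gamma c1 ** gamma c2) (X c2) l0).
    by exists e.
  exists 0 => e [g [u [_ _ _ hu]]]; apply: le_trans (hu 0 _) => //.
  by rewrite lexx ltW.
have [e [g [u [h [g0 u0] [g1 u1] hu]]] he] := inf_adherent l0 hS.
have := hpath_affine (gamma c1) 1 (- c1) 1 h; rewrite mulr1 => h'.
eexists (_, _); split; first exact: h'.
- by rewrite /= mul1r addNr g0 u0 dil1 gmul0r scale1r.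
- by rewrite /= mul1r addrC g1 u1 dil1 gmulKVg scale1r.
- move=> e' he' t /andP[t1 t2]; rewrite /= scale1r mul1r (addrC (- c1)).
  apply: le_trans (hu _ _) _; first by rewrite subr_ge0 t1 lerD2r.
  apply/ltW/(lt_le_trans he); rewrite lerD2r; apply: ge_inf => //; exact: (proj2 hS).
Qed.

Lemma norm_pair_lt (x : V) (y : U) e : (`|(x, y)| < e) = (`|x| < e) && (`|y| < e).
Proof. by rewrite [ltLHS]prod_normE /= gt_max. Qed.

(** By [short_gap] some curve in the gap has a velocity close to [X t], hence
    so does the chosen one, and then its displacement is small. *)
Lemma fills_close t e : K t -> 0 < e -> exists2 d, 0 < d & forall c1 c2 g u s,
  K c1 -> K c2 -> fills c1 c2 g u -> `|c1 - t| < d -> `|c2 - t| < d -> c1 < s < c2 ->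
  `|(g s, u s) - (gamma t, X t)| < e.
Proof.
move=> Kt e0; have e60 : 0 < e / 6 by lra.
have [C C0 hC] := hpath_stay G.
have [d1 d10 hd1] := short_gap Kt e60.
have [d2 d20 hd2] := gmul_near G (gamma t) 0 e0.
have [d3 d30 hd3] := (cont_inP _ _ _).1 (deriv_in_cont (deriv_in_gamma Kt)) _ d20.
have [d4 d40 hd4] := (cont_inP _ _ _).1 (within_cont_in cX Kt) _ e60.
pose M := `|X t| + e.
have M0 : 0 < M by rewrite ltr_wpDl.
have CM0 : 0 < C * M by rewrite mulr_gt0.
(* [C * M * (c2 - c1)] will be smaller than 1 and [d2] in gaps closer than [d5]. *)
pose d5 := Num.min 1 d2 / (C * M) / 2.
have m0 : 0 < Num.min 1 d2 by rewrite lt_min ltr01.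
have d50 : 0 < d5 by rewrite !divr_gt0.
exists (Num.min (Num.min (Num.min d1 d3) (Num.min d4 (e / 6))) d5).
  by rewrite !lt_min d10 d30 d40 e60 d50.
move=> c1 c2 g u s K1 K2 [h [g1 u1] _ hu].
rewrite !lt_min => /andP[/andP[/andP[cd1 cd3] /andP[cd4 cd6]] cd5].
move=> /andP[/andP[/andP[rd1 rd3] /andP[rd4 rd6]] rd5] /andP[c1s sc2].
have width d : `|c1 - t| < d -> `|c2 - t| < d -> c2 - c1 < 2 * d.
  exact: dist_lt_double.
have ub x : c1 <= x <= s -> `|u x - X t| < e.
  move=> /andP[x1 xs]; rewrite -[u x](subrK (X c1)) -addrA.
  apply: le_lt_trans (ler_normD _ _) _.
  have h1 : `|u x - X c1| <= e / 6 + (c2 - c1).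
    apply: hu; last by rewrite x1 (le_trans xs)// ltW.
    exact: (hd1 c1 c2 K1 K2 (lt_trans c1s sc2) cd1 rd1).
  have := width _ cd6 rd6; have := hd4 _ K1 cd4; move: h1; lra.
(* The displacement since [c1], seen from the identity. *)
have gb : `|- gamma c1 ** g s| < d2.
  have := hpath_affine (- gamma c1) 1 c1 1 h; rewrite mulr1 => h'.
  have E : - gamma c1 ** g s = - gamma c1 ** dil G 1 (g (c1 + 1 * (s - c1))).
    by rewrite dil1 mul1r addrC subrK.
  have ss : C * M * (s - c1) < Num.min 1 d2.
    rewrite mulrC -ltr_pdivlMr//; apply: le_lt_trans (_ : c2 - c1 < _).
      by rewrite lerD2r ltW.
    by apply: lt_le_trans (width _ cd5 rd5) _; rewrite /d5 mulrC mulfVK.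
  move: (ss); rewrite lt_min => /andP[ss1]; apply: le_lt_trans; rewrite E.
  apply: (hC _ _ M _ h') => //.
  - by rewrite dil1 mulr0 addr0 g1 gmulVg.
  - by rewrite subr_ge0 ltW.
  - move=> x /andP[x0 xs]; rewrite scale1r mul1r.
    rewrite -[u _](subrK (X t)) addrC; apply: le_trans (ler_normD _ _) _.
    by rewrite lerD2l ltW// ub// lerDl x0 addrC -lerBrDr.
rewrite norm_pair_lt; apply/andP; split.
  rewrite -[X in `|_ - X|](gmul0r G) -[g s](gmulKVg G (gamma c1)).
  by apply: hd2; [exact: hd3|rewrite subr0].
by apply: ub; rewrite lexx ltW.
Qed.

Lemma cont_in_pair (A : set R) (f : R -> V) (g : R -> U) t :
  cont_in A f t -> cont_in A g t -> cont_in A (fun s => (f s, g s)) t.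
Proof.
move=> [hf] [hg]; split=> e e0; have [d d0 hd] := hf e e0; have [d' d'0 hd'] := hg e e0.
exists (Num.min d d'); first by rewrite lt_min d0.
move=> s As; rewrite lt_min => /andP[/(hd _ As) h1 /(hd' _ As) h2].
by rewrite norm_pair_lt h1.
Qed.

Lemma near_lfield (p0 : V) (u0 : U) e : 0 < e -> exists2 d, 0 < d & forall p u,
  `|(p, u) - (p0, u0)| < d -> `|lfield G p (hor u) - lfield G p0 (hor u0)| <= e.
Proof.
move=> e0; have e20 : 0 < e / 2 by lra.
have /cvgrPdistC_lt/(_ _ e20)/nbhs_ballP[d /= d0 hd] := @lfield_continuous R r m G (hor u0) p0.
have [C C0 hC] := linear_family_bounded (fun p => lfield_linear G p) (@lfield_continuous R r m G) (`|p0| + 1).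
exists (Num.min (Num.min d 1) (e / 2 / C)); first by rewrite !lt_min d0 ltr01 !divr_gt0.
move=> p u; rewrite norm_pair_lt !lt_min => /andP[/andP[/andP[pd p1] _] /andP[_ uC]].
have -> : lfield G p (hor u) - lfield G p0 (hor u0) =
    lfield G p (hor u - hor u0) + (lfield G p (hor u0) - lfield G p0 (hor u0)).
  by rewrite (linear_eqB _ _ (lfield_linear _ _)) addrA subrK.
apply: le_trans (ler_normD _ _) _; rewrite (splitr e) lerD//; last first.
  by apply/ltW/hd; rewrite -ball_normE /= distrC.
apply: le_trans (hC _ _ _) _.
  rewrite -[p](subrK p0) addrC; apply: le_trans (ler_normD _ _) _.
  by rewrite lerD2l ltW.
rewrite mulrC -ler_pdivlMr// -(linear_eqB _ _ (@hor_linear R r m)).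
exact: le_trans (hor_norm _) (ltW uC).
Qed.

Lemma glue_fillings (fl : R * R -> (R -> V) * (R -> U)) :
  (forall c1 c2, gap K c1 c2 -> fills c1 c2 (fl (c1, c2)).1 (fl (c1, c2)).2) ->
  exists g u, (forall t, K t -> g t = gamma t /\ u t = X t) /\
    forall c1 c2, gap K c1 c2 -> forall s, c1 <= s <= c2 ->
      g s = (fl (c1, c2)).1 s /\ u s = (fl (c1, c2)).2 s.
Proof.
move=> hfl.
have /choice[p hp] : forall s, exists p : R * R, forall c1 c2, ~ K s -> gap K c1 c2 ->
    c1 < s < c2 -> p = (c1, c2).
  move=> s; have [[c1 [c2 [hc cs]]]|nc] := pselect (exists c1 c2, gap K c1 c2 /\ c1 < s < c2).
    by exists (c1, c2) => d1 d2 _ hd ds; have [-> ->] := gap_unique hc hd cs ds.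
  by exists (0, 0) => c1 c2 _ hc cs; exfalso; apply: nc; exists c1, c2.
exists (fun s => if pselect (K s) then gamma s else (fl (p s)).1 s),
  (fun s => if pselect (K s) then X s else (fl (p s)).2 s).
split=> [t Kt|c1 c2 hc s /andP[]]; first by case: pselect.
have [K1 K2 c12 nK] := hc; have [_ [g1 u1] [g2 u2] _] := hfl _ _ hc.
rewrite le_eqVlt => /predU1P[<-|c1s]; first by case: pselect => // _; rewrite g1 u1.
rewrite le_eqVlt => /predU1P[->|sc2]; first by case: pselect => // _; rewrite g2 u2.
case: pselect => [Ks|nKs]; first by exfalso; exact: nK Ks c1s sc2.
by rewrite (hp s c1 c2)// c1s.
Qed.

Section Filled.
Context (a b : R) (Ka : K a) (Kb : K b) (g : R -> V) (u : R -> U).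
Context (Kab : forall k, K k -> a <= k <= b).
Context (onK : forall t, K t -> g t = gamma t /\ u t = X t).
Context (on_gap : forall c1 c2, gap K c1 c2 -> hpath G `[c1, c2] g u).
Context (close : forall t e, K t -> 0 < e -> exists2 d, 0 < d & forall c1 c2 s,
  gap K c1 c2 -> `|c1 - t| < d -> `|c2 - t| < d -> c1 < s < c2 ->
  `|(g s, u s) - (gamma t, X t)| < e).

(** At points of [K] this is the continuity of [gamma] and [X]; at points of
    the gaps it is [close]. *)
Lemma filled_close t e : K t -> 0 < e -> exists2 d, 0 < d & forall s, a <= s <= b ->
  `|s - t| < d -> (forall c1 c2, gap K c1 c2 -> c1 < s < c2 -> `|c1 - t| < d /\ `|c2 - t| < d) ->
  `|(g s, u s) - (g t, u t)| < e.
Proof.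
move=> Kt e0; have [gt ut] := onK Kt.
have [d1 d10 hd1] := close Kt e0.
have [d2 d20 hd2] := (cont_inP _ _ _).1
  (cont_in_pair (deriv_in_cont (deriv_in_gamma Kt)) (within_cont_in cX Kt)) _ e0.
exists (Num.min d1 d2); first by rewrite lt_min d10.
move=> s sab; rewrite lt_min => /andP[_ st] hs; rewrite gt ut.
have [Ks|nKs] := pselect (K s); first by have [-> ->] := onK Ks; exact: hd2.
have [c1 [c2 [hc cs]]] := gap_around cK Ka Kb sab nKs.
have [] := hs _ _ hc cs; rewrite !lt_min => /andP[h1 _] /andP[h2 _].
exact: hd1 hc h1 h2 cs.
Qed.

(** On each side of [t], either a gap begins at [t] and its filling is
    continuous, or [K] accumulates at [t] and then the gaps near [t] are
    short. *)
Lemma filled_cont t : K t -> cont_in `[a, b] (fun s => (g s, u s)) t.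
Proof.
move=> Kt; have /andP[at_ tb] := Kab Kt.
apply: (cont_in_glue (b := t)) => _.
- move: at_; rewrite le_eqVlt => /predU1P[<-|ta].
    split=> e ep; exists 1 => // s [] /=; rewrite in_itv /= => /andP[as_ _] sa _.
    by have -> : s = a; [apply/eqP; rewrite eq_le as_ sa|rewrite subrr normr0].
  have [[c hc]|acc] := gap_left cK Ka Kt ta.
    have [_ _ ct _] := hc; have [|h1 h2] := on_gap hc (t := t).
      by rewrite /= in_itv /= lexx ltW.
    have d0 : 0 < t - c by rewrite subr_gt0.
    apply: (cont_in_local d0 _ (cont_in_pair (deriv_in_cont h1) h2)) => s [_ /= st] h3.
    rewrite in_itv /= st andbT; have := ler_norm (- (s - t)); rewrite normrN.
    by lra.
  split=> e ep; have [d d0 hd] := filled_close Kt ep.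
  have [k [Kk kd kt]] := acc d d0.
  exists (t - k); first by rewrite subr_gt0.
  move=> s [/=]; rewrite in_itv /= => sab st sk; have dk : t - k < d by lra.
  have ks : k <= s.
    by have := ler_norm (- (s - t)); rewrite normrN; lra.
  apply: hd => //; first exact: lt_trans dk.
  move=> c1 c2 hc cs; have q1 := gap_le hc cs Kk ks; have q2 := gap_ge hc cs Kt st.
  have [_ _ c12 _] := hc; rewrite !ler0_norm ?subr_le0//; last exact: le_trans (ltW c12) q2.
  by split; lra.
- move: tb; rewrite le_eqVlt => /predU1P[->|tb].
    split=> e ep; exists 1 => // s [] /=; rewrite in_itv /= => /andP[_ sb] bs _.
    by have -> : s = b; [apply/eqP; rewrite eq_le sb bs|rewrite subrr normr0].
  have [[c hc]|acc] := gap_right cK Kb Kt tb.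
    have [_ _ ct _] := hc; have [|h1 h2] := on_gap hc (t := t).
      by rewrite /= in_itv /= lexx ltW.
    have d0 : 0 < c - t by rewrite subr_gt0.
    apply: (cont_in_local d0 _ (cont_in_pair (deriv_in_cont h1) h2)) => s [_ /= st] h3.
    by rewrite in_itv /= st /=; have := ler_norm (s - t); lra.
  split=> e ep; have [d d0 hd] := filled_close Kt ep.
  have [k [Kk kt kd]] := acc d d0.
  exists (k - t); first by rewrite subr_gt0.
  move=> s [/=]; rewrite in_itv /= => sab st sk; have dk : k - t < d by lra.
  have ks : s <= k by have := ler_norm (s - t); lra.
  apply: hd => //; first exact: lt_trans dk.
  move=> c1 c2 hc cs; have q1 := gap_le hc cs Kt st; have q2 := gap_ge hc cs Kk ks.
  have [_ _ c12 _] := hc; rewrite !ger0_norm ?subr_ge0//; last exact: le_trans q1 (ltW c12).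
  by split; lra.
Qed.

(** The increment from [t] to [s] splits at the end of the gap of [s] that
    lies between them. Up to this point of [K] the Whitney condition applies;
    beyond it the mean value inequality does, the velocity being continuous at
    [t]. *)
Lemma filled_deriv t : K t -> deriv_in `[a, b] g t (lfield G (g t) (hor (u t))).
Proof.
move=> Kt; have [gt ut] := onK Kt; split=> e e0; pose v := lfield G (g t) (hor (u t)).
have [d1 d10 hd1] := near_lfield (g t) (u t) e0.
have [d2 d20 hd2] := (cont_inP _ _ _).1 (filled_cont Kt) _ d10.
have [d3 d30 hd3] := (deriv_inP _ _ _ _).1 (deriv_in_gamma Kt) _ e0.
exists (Num.min d2 d3); first by rewrite lt_min d20.
have base k : K k -> `|k - t| < d3 -> `|g k - g t - (k - t) *: v| <= e * `|k - t|.
  by move=> Kk kd; have [-> _] := onK Kk; rewrite /v gt ut; exact: hd3.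
have tri (k s : R) : `|g s - g t - (s - t) *: v| <=
    `|g s - g k - (s - k) *: v| + `|g k - g t - (k - t) *: v|.
  apply: le_trans (ler_normD _ _); rewrite le_eqVlt; apply/orP; left; apply/eqP.
  congr (`|_|); rewrite [RHS]addrACA -opprD -scalerDl.
  by congr (_ - _ *: _); rewrite addrA subrK.
(* The mean value inequality inside one gap, near [t]. *)
have inside c1 c2 x y : gap K c1 c2 -> c1 <= x -> x <= y -> y <= c2 ->
    (forall z, x <= z <= y -> `|z - t| < d2) ->
    `|g y - g x - (y - x) *: v| <= e * (y - x).
  move=> hc c1x xy yc2 hz; have [K1 K2 _ _] := hc.
  have /andP[ac1 _] := Kab K1; have /andP[_ c2b] := Kab K2.
  apply: (@mean_value R _ g (fun z => lfield G (g z) (hor (u z)))) => // z /andP[xz zy].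
    have [|hgz _] := on_gap hc (t := z).
      by rewrite /= in_itv /= (le_trans c1x xz) (le_trans zy).
    by apply: deriv_inS hgz; apply: subset_itv; rewrite bnd_simp.
  apply: hd1; apply: hd2; last by apply: hz; rewrite xz.
  by rewrite /= in_itv /= (le_trans ac1 (le_trans c1x xz)) (le_trans zy (le_trans yc2 c2b)).
move=> s; rewrite /= in_itv /= => sab; rewrite lt_min => /andP[sd2 sd3].
have [Ks|nKs] := pselect (K s); first exact: base.
have [c1 [c2 [hc cs]]] := gap_around cK Ka Kb sab nKs.
have [K1 K2 c12 _] := hc; have /andP[c1s sc2] := cs.
case: (leP t s) => [ts|st].
  have tc := gap_le hc cs Kt ts.
  rewrite ger0_norm ?subr_ge0// in sd2 sd3 *.
  apply: le_trans (tri c1 s) _; have E : `|c1 - t| = c1 - t by rewrite ger0_norm ?subr_ge0.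
  have -> : e * (s - t) = e * (s - c1) + e * `|c1 - t| by rewrite E; ring.
  apply: lerD; last by apply: base; rewrite // E; lra.
  apply: (inside c1 c2) => //; [exact: ltW|exact: ltW|].
  move=> z /andP[z1 zs]; rewrite ger0_norm ?subr_ge0 ?(le_trans tc z1)//.
  by lra.
have ct := gap_ge hc cs Kt (ltW st).
rewrite ltr0_norm ?subr_lt0// opprB in sd2 sd3 *.
apply: le_trans (tri c2 s) _.
have E : `|c2 - t| = t - c2 by rewrite ler0_norm ?subr_le0// opprB.
have -> : e * (t - s) = e * (c2 - s) + e * `|c2 - t| by rewrite E; ring.
apply: lerD; last by apply: base; rewrite // E; lra.
rewrite -normrN opprD opprB -scaleNr opprB.
apply: (inside c1 c2) => //; [exact: ltW|exact: ltW|].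
move=> z /andP[z1 zs]; rewrite ler0_norm ?subr_le0 ?(le_trans zs ct)//.
by lra.
Qed.

Lemma filled_hpath : hpath G `[a, b] g u.
Proof.
move=> t tI; have tab : a <= t <= b by move: tI; rewrite /= in_itv.
have [Kt|nKt] := pselect (K t).
  split; first exact: filled_deriv.
  split=> e e0; have [d d0 hd] := (cont_inP _ _ _).1 (filled_cont Kt) e e0.
  by exists d => // s sI sd; have := hd s sI sd; rewrite norm_pair_lt => /andP[].
have [c1 [c2 [hc /andP[c1t tc2]]]] := gap_around cK Ka Kb tab nKt.
have d0 : 0 < Num.min (t - c1) (c2 - t) by rewrite lt_min !subr_gt0 c1t.
have hB s : `[a, b]%classic s -> `|s - t| < Num.min (t - c1) (c2 - t) ->
    `[c1, c2]%classic s.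
  move=> _; rewrite lt_min /= in_itv /= => /andP[h1 h2].
  have := ler_norm (s - t); have := ler_norm (- (s - t)); rewrite normrN.
  by move=> h3 h4; apply/andP; split; lra.
have [|h1 h2] := on_gap hc (t := t); first by rewrite /= in_itv /= !ltW.
by split; [exact: deriv_in_local d0 hB h1|exact: cont_in_local d0 hB h2].
Qed.

End Filled.

Lemma whitney_segment a b : K a -> K b -> (forall k, K k -> a <= k <= b) ->
  exists g u, hpath G `[a, b] g u /\ forall t, K t -> g t = gamma t /\ u t = X t.
Proof.
move=> Ka Kb Kab.
have /choice[fl hfl] : forall p : R * R, exists gu : (R -> V) * (R -> U),
    gap K p.1 p.2 -> fills p.1 p.2 gu.1 gu.2.
  move=> [c1 c2] /=; have [[K1 K2 c12 _]|nh] := pselect (gap K c1 c2).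
    by have [gu hgu] := fills_exists K1 c12; exists gu.
  by exists (fun=> 0, fun=> 0) => hc; exfalso; exact: nh hc.
have {}hfl c1 c2 : gap K c1 c2 -> fills c1 c2 (fl (c1, c2)).1 (fl (c1, c2)).2 := hfl (c1, c2).
have [g [u [onK ong]]] := glue_fillings hfl.
exists g, u; split => //; apply: filled_hpath => //.
  move=> c1 c2 hc t tI; have [h _ _ _] := hfl _ _ hc; have [h1 h2] := h t I.
  have E s : `[c1, c2]%classic s -> (fl (c1, c2)).1 s = g s /\ (fl (c1, c2)).2 s = u s.
    by rewrite /= in_itv /= => sI; have [-> ->] := ong _ _ hc s sI.
  have [E1 E2] := E t tI; rewrite -E1 -E2; split.
    by apply: deriv_in_eq (deriv_inS (@subsetT _ _) h1) => // s /E[].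
  by apply: cont_in_eq (cont_inS (@subsetT _ _) h2) => // s /E[].
move=> t e Kt e0; have [d d0 hd] := fills_close Kt e0; exists d => // c1 c2 s hc h1 h2 cs.
have [K1 K2 _ _] := hc; have /andP[c1s sc2] := cs.
have sI : c1 <= s <= c2 by rewrite !ltW.
have [-> ->] := ong _ _ hc s sI.
exact: hd (hfl _ _ hc) h1 h2 cs.
Qed.

End Whitney.

Theorem theorem1p1 (R : realType) (r m : nat) (G : carnot_group R r m)
    (O : set 'rV[R]_r) :
  (forall V, O V -> pliable_vector G V) -> whitney_extension G O.
Proof.
move=> pO K gamma X cK cg cX XO rate0.
have pX t : K t -> pliable_vector G (X t) by move=> /XO/pO.
have mk g u : hpath G setT g u -> (forall t, K t -> g t = gamma t /\ u t = X t) ->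
    exists Gamma : C1H G setT, forall t, K t -> Gamma t = gamma t /\ velocity Gamma t = X t.
  move=> h hK.
  have hd t : setT t -> is_derive_within setT g t (linv G (hor (u t)) (g t)).
    by move=> _; apply/deriv_in_within; rewrite linvE; have [] := h t I.
  have hc : {within setT, continuous u}.
    by apply: continuous_subspaceT; apply/continuous_cont_in => t; have [] := h t I.
  by exists (MkC1H hd hc).
have [[x Kx]|K0] := pselect (exists x, K x); last first.
  apply: (mk _ _ (@hpath_ray R r m G setT 0 0 0)) => t Kt.
  by exfalso; apply: K0; exists t.
have [a Ka ha] := compact_has_min cK Kx; have [b Kb hb] := compact_has_max cK Kx.
have Kab k : K k -> a <= k <= b by move=> Kk; rewrite ha ?hb.
have [g [u [h hK]]] := whitney_segment cK cX rate0 pX Ka Kb Kab.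
(* Beyond the extreme points of [K] the curve follows one-parameter subgroups. *)
have [g' [u' [h' hgu]]] := hpath_extend (hb a Ka) h.
apply: (mk g' u' h') => t Kt; have [-> ->] := hgu t (Kab t Kt); exact: hK.
Qed.
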